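(* Let $E$ be the elliptic curve $X_1(15)$ over $\mathbb{Q}$, with Weierstrass model $y^2=x^3-7x^2+16x$. Let $p$ be a prime with $p\equiv 7\pmod 8$, $p\equiv 2\pmod 3$ and $\left(\frac{p}{5}\right)=-1$. Then $\operatorname{rank}E^{(p)}(\mathbb{Q})=\operatorname{rank}E^{(-15p)}(\mathbb{Q})=0$.
   Context: $X_1(15)$ is the modular curve classifying elliptic curves with a point of order $15$; it is an elliptic curve over $\mathbb{Q}$. For an elliptic curve $y^2=x^3+ax^2+bx$ and $d\in\mathbb{Q}^*$, its quadratic twist by $d$ is $E^{(d)}:y^2=x^3+adx^2+bd^2x$. $\left(\frac{p}{5}\right)$ is the Legendre symbol. *)

(* Defs.v *)
From HB Require Import structures.
From mathcomp Require Import all_boot all_order all_algebra.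
From mathcomp Require Import ring.
Set Implicit Arguments. Unset Strict Implicit. Unset Printing Implicit Defensive.
Import GRing.Theory.
Local Open Scope ring_scope.

Section Slopes.

(* Associativity of the chord-and-tangent law in the generic case, with the
   x-coordinates measured from the middle point.  For points A, B, C on
   Y^2 = f(X), with f monic cubic, put B = (xB, y), A = (xB + u, y + l u) and
   C = (xB + v, y + m v), where k = f'(xB), h = f''(xB) / 2.  Then (X, Y) is
   A + B, (X', Y') is B + C, and l, m, n, r are the slopes of the lines through
   A, B; B, C; A + B, C and A, B + C.  The cases differ in whether the last two
   lines are tangent. *)
Variables (K : fieldType).

Lemma solve_div (d n e : K) : d != 0 -> d * n = e -> n = e / d.
Proof. by move=> nd <-; rewrite mulrC mulKf. Qed.

Lemma core1 (h k y u v l m n r X Y X' Y' : K) :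
  X = l ^+ 2 - h - u -> Y = - (y + l * X) ->
  X' = m ^+ 2 - h - v -> Y' = - (y + m * X') ->
  u - v != 0 ->
  k + h * u + u ^+ 2 = 2 * l * y + l ^+ 2 * u ->
  k + h * v + v ^+ 2 = 2 * m * y + m ^+ 2 * v ->
  (X - v) * n = Y - (y + m * v) -> X - v != 0 ->
  (X' - u) * r = Y' - (y + l * u) -> X' - u != 0 ->
  [/\ l + n = m + r, n ^+ 2 - X - v = r ^+ 2 - X' - u &
    n * (X - (n ^+ 2 - h - X - v)) - Y =
    r * (u - (r ^+ 2 - h - X' - u)) - (y + l * u)].
Proof.
move=> dX dY dX' dY' uv e1 e2 en nX er nX'.
have eh : h = (2 * (l - m) * y + l ^+ 2 * u - m ^+ 2 * v - u ^+ 2 + v ^+ 2) / (u - v).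
  apply: solve_div => //.
  have -> : (u - v) * h = (k + h * u + u ^+ 2) - (k + h * v + v ^+ 2) - u ^+ 2 + v ^+ 2 by ring.
  by rewrite e1 e2; ring.
have {en}dn := solve_div nX en; have {er}dr := solve_div nX' er; clear e1 e2.
have := mulf_neq0 nX uv; have := mulf_neq0 nX' uv.
rewrite dX dX' !mulrBl eh mulfVK // -eh => nX'' nX'''.
by split; subst n r Y Y' X X' h; field; rewrite uv -!mulNr !mulNr nX'' nX'''.
Qed.

Lemma core2 (h k y u v l m n r X Y X' Y' : K) :
  X = l ^+ 2 - h - u -> Y = - (y + l * X) ->
  X' = m ^+ 2 - h - v -> Y' = - (y + m * X') ->
  (2 : K) != 0 ->
  k + h * u + u ^+ 2 = 2 * l * y + l ^+ 2 * u ->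
  X = v -> Y = y + m * v -> Y != 0 -> 
  2 * Y * n = k + 2 * h * v + 3 * v ^+ 2 ->
  (X' - u) * r = Y' - (y + l * u) -> X' - u != 0 ->
  [/\ l + n = m + r, n ^+ 2 - X - v = r ^+ 2 - X' - u &
    n * (X - (n ^+ 2 - h - X - v)) - Y =
    r * (u - (r ^+ 2 - h - X' - u)) - (y + l * u)].
Proof.
move=> dX dY dX' dY' n2 e1 eX eY nY en er nX'.
have {en}dn := solve_div (mulf_neq0 n2 nY) en; have {er}dr := solve_div nX' er.
have dh : h = l ^+ 2 - u - v by rewrite -eX dX; ring.
have dk : k = 2 * l * y + l ^+ 2 * u - u ^+ 2 - h * u by rewrite -e1; ring.
have dy : y = - (l + m) * v / 2.
  apply: solve_div => //.
  have -> : 2 * y = (y + m * v) - m * v + y by ring.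
  by rewrite -eY dY eX; ring.
have nY1 : (m - l) * v != 0.
  apply: contraNneq nY => e0; rewrite -(inj_eq (mulfI n2)) eY dy.
  by apply/eqP; rewrite mulr0 -e0; field.
have nX1 : m ^+ 2 - l ^+ 2 != 0.
  by apply: contraNneq nX' => e0; rewrite dX' dh -e0; apply/eqP; ring.
clear e1 nX' nY.
have nX2 : X' - u = m ^+ 2 - l ^+ 2 by rewrite dX' dh; ring.
have nY2 : Y = (m - l) * v / 2 by rewrite eY dy; field.
clear eY.
rewrite dr dn nX2 dY' dX' dk eX dh dy nY2.
move: nY1; rewrite mulf_eq0 negb_or => /andP[nl nv].
by split; field; rewrite n2 nX1 nl nv.
Qed.

Lemma core3 (h k y u v l m n r X Y X' Y' : K) :
  X = l ^+ 2 - h - u -> Y = - (y + l * X) ->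
  X' = m ^+ 2 - h - v -> Y' = - (y + m * X') ->
  (2 : K) != 0 -> u - v != 0 ->
  k + h * u + u ^+ 2 = 2 * l * y + l ^+ 2 * u ->
  X = v -> Y = y + m * v -> Y != 0 -> 
  2 * Y * n = k + 2 * h * v + 3 * v ^+ 2 ->
  X' = u -> Y' = y + l * u -> Y' != 0 -> 
  2 * Y' * r = k + 2 * h * u + 3 * u ^+ 2 ->
  [/\ l + n = m + r, n ^+ 2 - X - v = r ^+ 2 - X' - u &
    n * (X - (n ^+ 2 - h - X - v)) - Y =
    r * (u - (r ^+ 2 - h - X' - u)) - (y + l * u)].
Proof.
move=> dX dY dX' dY' n2 uv e1 eX eY nY en eX' eY' nY' er.
have {en}dn := solve_div (mulf_neq0 n2 nY) en.
have {er}dr := solve_div (mulf_neq0 n2 nY') er.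
have dh : h = l ^+ 2 - u - v by rewrite -eX dX; ring.
have dk : k = 2 * l * y + l ^+ 2 * u - u ^+ 2 - h * u by rewrite -e1; ring.
have dm : m = - l.
  apply/eqP; rewrite -subr_eq0 opprK -(inj_eq (mulIf uv)) mul0r.
  have -> : (m + l) * (u - v) = (- (y + l * v) - (y + m * v)) - (- (y + m * u) - (y + l * u)) by ring.
  by rewrite -eY -eY' dY dY' eX eX' !subrr.
have dy : y = 0.
  apply/eqP; rewrite -(inj_eq (mulfI n2)) mulr0; apply/eqP.
  have -> : 2 * y = (y + m * v) - (- (y + l * v)) - (m + l) * v by ring.
  by rewrite -eY dY dm eX; ring.
have fY : Y = - (l * v) by rewrite dY dy eX; ring.
have fY' : Y' = l * u by rewrite dY' dy eX' dm; ring.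
move: nY nY'; rewrite dn dr eX eX' fY fY' dk dm dh dy oppr_eq0 !mulf_eq0 !negb_or.
move=> /andP[nl nv] /andP[_ nu].
by split; field; rewrite ?n2 ?nl ?nv ?nu ?oppr_eq0 ?mulf_neq0.
Qed.

Lemma coreP (h k y u v l m n r X Y X' Y' : K) :
  X = l ^+ 2 - h - u -> Y = - (y + l * X) ->
  X' = m ^+ 2 - h - v -> Y' = - (y + m * X') ->
  (2 : K) != 0 -> u - v != 0 ->
  k + h * u + u ^+ 2 = 2 * l * y + l ^+ 2 * u ->
  k + h * v + v ^+ 2 = 2 * m * y + m ^+ 2 * v ->
  (X - v) * n = Y - (y + m * v) ->
  (X = v -> [/\ Y = y + m * v, Y != 0 & 2 * Y * n = k + 2 * h * v + 3 * v ^+ 2]) ->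
  (X' - u) * r = Y' - (y + l * u) ->
  (X' = u -> [/\ Y' = y + l * u, Y' != 0 & 2 * Y' * r = k + 2 * h * u + 3 * u ^+ 2]) ->
  [/\ l + n = m + r, n ^+ 2 - X - v = r ^+ 2 - X' - u &
    n * (X - (n ^+ 2 - h - X - v)) - Y =
    r * (u - (r ^+ 2 - h - X' - u)) - (y + l * u)].
Proof.
move=> dX dY dX' dY' n2 uv e1 e2 en tn er tr.
have [/eqP|nX] := eqVneq (X - v) 0; have [/eqP|nX'] := eqVneq (X' - u) 0.
- rewrite !subr_eq0 => /eqP eX' /eqP eX.
  have [? ? ?] := tn eX; have [? ? ?] := tr eX'.
  by apply: (@core3 h k y _ _ _ _ _ _ _ Y _ Y').
- rewrite subr_eq0 => /eqP eX; have [? ? ?] := tn eX.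
  by apply: (@core2 h k y _ _ _ _ _ _ _ Y _ Y').
- rewrite subr_eq0 => /eqP eX'; have [f1 f2 f3] := tr eX'.
  have [g1 g2 g3] := core2 dX' dY' dX dY n2 e2 eX' f1 f2 f3 en nX.
  split=> //.
  have -> : n * (X - (n ^+ 2 - h - X - v)) =
      (X - v) * n + n * (v - (n ^+ 2 - h - X - v)) by ring.
  have -> : n * (v - (n ^+ 2 - h - X - v)) =
      r * (X' - (r ^+ 2 - h - X' - u)) - Y' + (y + m * v) by rewrite g3; ring.
  by rewrite en f1 eX'; ring.
- by apply: (@core1 h k y _ _ _ _ _ _ _ Y _ Y').
Qed.
End Slopes.

(* The curve y^2 = x^3 + coef_a x^2 + coef_b x; the number required to be
   nonzero is its discriminant. *)
Record ecurve (K : fieldType) := ECurve {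
  coef_a : K;
  coef_b : K;
  disc_neq0 : 16 * coef_b ^+ 2 * (coef_a ^+ 2 - 4 * coef_b) != 0
}.

Section GroupLaw.
Variables (K : fieldType) (E : ecurve K).
Local Notation a := (coef_a E).
Local Notation b := (coef_b E).

(* None stands for the point at infinity. *)
Definition oncurve (P : option (K * K)) : bool :=
  if P is Some (x, y) then y ^+ 2 == x ^+ 3 + a * x ^+ 2 + b * x else true.

Definition eopp (P : option (K * K)) : option (K * K) :=
  if P is Some (x, y) then Some (x, - y) else None.

Definition slope (x1 y1 x2 y2 : K) : K :=
  if x1 == x2 then (3 * x1 ^+ 2 + 2 * a * x1 + b) / (2 * y1)
  else (y2 - y1) / (x2 - x1).

Definition eadd (P Q : option (K * K)) : option (K * K) :=
  match P, Q with
  | None, _ => Q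
  | _, None => P
  | Some (x1, y1), Some (x2, y2) =>
    if (x1 == x2) && (y1 == - y2) then None else
    let l := slope x1 y1 x2 y2 in
    let x3 := l ^+ 2 - a - x1 - x2 in
    Some (x3, l * (x1 - x3) - y1)
  end.

Lemma two_neq0 : (2 : K) != 0.
Proof.
apply: contraNneq (disc_neq0 E) => e2.
have -> : (16 : K) = 2 * 8 by rewrite -natrM.
by rewrite e2 !mul0r.
Qed.

Lemma smooth x : x ^+ 3 + a * x ^+ 2 + b * x = 0 ->
  3 * x ^+ 2 + 2 * a * x + b != 0.
Proof.
move=> fx; apply: contraNneq (disc_neq0 E) => f'x.
have /eqP : x * (x ^+ 2 + a * x + b) = 0 by rewrite -fx; ring.
rewrite mulf_eq0 => /orP[/eqP x0|/eqP q0].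
  have -> : b = 0 by rewrite -f'x x0; ring.
  by apply/eqP; ring.
have /eqP : x * (2 * x + a) = 0 by rewrite -[RHS](subrr 0) -{1}f'x -q0; ring.
rewrite mulf_eq0 => /orP[/eqP x0|/eqP q1].
  have -> : b = 0 by rewrite -q0 x0; ring.
  by apply/eqP; ring.
have -> : a ^+ 2 - 4 * b = (2 * x + a) ^+ 2 - 4 * (x ^+ 2 + a * x + b) by ring.
by rewrite q0 q1; apply/eqP; ring.
Qed.

(* The line of slope l through (x1, y1) and (x2, y2), tangent if the points
   coincide; the second equation is the first one divided out by x2 - x1. *)
Definition chord x1 y1 x2 y2 (l : K) :=
  (x2 - x1) * l = y2 - y1 /\
  (y1 + y2) * l = x1 ^+ 2 + x1 * x2 + x2 ^+ 2 + a * (x1 + x2) + b.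

Definition third x1 y1 x2 (l : K) :=
  let x3 := l ^+ 2 - a - x1 - x2 in Some (x3, l * (x1 - x3) - y1).

Lemma oncurve_eqx x y y' : oncurve (Some (x, y)) -> oncurve (Some (x, y')) ->
  y = y' \/ y = - y'.
Proof.
move=> /eqP e /eqP e'; have /eqP : y ^+ 2 = y' ^+ 2 by rewrite e e'.
by rewrite eqf_sqr => /orP[]/eqP; [left|right].
Qed.

Lemma chord_slope x1 y1 x2 y2 :
  oncurve (Some (x1, y1)) -> oncurve (Some (x2, y2)) ->
  ~~ ((x1 == x2) && (y1 == - y2)) -> chord x1 y1 x2 y2 (slope x1 y1 x2 y2).
Proof.
move=> P Q; rewrite /slope; case: eqVneq => [e|ne] /= ny.
  subst x2; case: (oncurve_eqx P Q) => [e|e]; last by rewrite e eqxx in ny.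
  subst y2; have y0 : y1 != 0.
    by apply: contraNneq ny => ->; rewrite oppr0.
  by split; [ring|field; rewrite ?two_neq0 ?y0].
move: P Q => /eqP P /eqP Q; have ne' : x2 - x1 != 0 by rewrite subr_eq0 eq_sym.
split; first by field.
apply: (mulIf ne'); rewrite -mulrA mulfVK //.
have -> : (y1 + y2) * (y2 - y1) = y2 ^+ 2 - y1 ^+ 2 by ring.
by rewrite P Q; ring.
Qed.

Lemma chord_uniq x1 y1 x2 y2 l l' : 
  oncurve (Some (x1, y1)) -> oncurve (Some (x2, y2)) ->
  ~~ ((x1 == x2) && (y1 == - y2)) -> 
  chord x1 y1 x2 y2 l -> chord x1 y1 x2 y2 l' -> l = l'.
Proof.
move=> P Q ny [c1 c2] [c1' c2']; move: ny.
rewrite negb_and -(subr_eq0 y1) opprK eq_sym -subr_eq0 => /orP[nx|ny].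
  by apply: (mulfI nx); rewrite c1 c1'.
by apply: (mulfI ny); rewrite c2 c2'.
Qed.

Lemma eaddE x1 y1 x2 y2 l :
  oncurve (Some (x1, y1)) -> oncurve (Some (x2, y2)) ->
  ~~ ((x1 == x2) && (y1 == - y2)) -> chord x1 y1 x2 y2 l ->
  eadd (Some (x1, y1)) (Some (x2, y2)) = third x1 y1 x2 l.
Proof.
move=> P Q ny c; rewrite /eadd (negPf ny).
by rewrite (chord_uniq P Q ny (chord_slope P Q ny) c).
Qed.

Lemma chord_third x1 y1 x2 y2 l (x3 := l ^+ 2 - a - x1 - x2)
    (y3 := l * (x1 - x3) - y1) :
  oncurve (Some (x1, y1)) -> chord x1 y1 x2 y2 l ->
  [/\ oncurve (Some (x3, y3)), chord x3 y3 x2 (- y2) (- l)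
     & (x3 == x2) && (y3 == - - y2) = false].
Proof.
move=> /eqP P [c1 c2].
have ey2 : y2 = y1 + l * (x2 - x1) by rewrite mulrC c1; ring.
have c : chord x3 y3 x2 (- y2) (- l).
  split; first by rewrite /y3 ey2; ring.
  have eb : b = (y1 + y2) * l - (x1 ^+ 2 + x1 * x2 + x2 ^+ 2 + a * (x1 + x2)).
    by rewrite c2; ring.
  by rewrite eb ey2 /y3 /x3; ring.
have C : oncurve (Some (x3, y3)).
  apply/eqP; have -> : x3 ^+ 3 + a * x3 ^+ 2 + b * x3 =
      y1 ^+ 2 + (x3 - x1) * ((y1 + y2) * l + (x3 - x2) * (a + x1 + x2 + x3)).
    by rewrite P c2; ring.
  by rewrite ey2 /y3 /x3; ring.
split=> //; rewrite opprK; apply/negP => /andP[/eqP ex /eqP ey].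
move: C c; rewrite ex ey => /eqP C [_ c].
have fx : x2 ^+ 3 + a * x2 ^+ 2 + b * x2 = 0.
  have e2 : 2 * y2 = 0.
    have -> : 2 * y2 = y3 + y2 by rewrite ey; ring.
    by rewrite /y3 ex ey2; ring.
  have y20 : y2 = 0 by apply: (mulfI two_neq0); rewrite e2 mulr0.
  by rewrite -C y20; ring.
move/eqP: (smooth fx); apply.
transitivity (x2 ^+ 2 + x2 * x2 + x2 ^+ 2 + a * (x2 + x2) + b); first by ring.
by rewrite -c; ring.
Qed.

Lemma oncurve_opp P : oncurve P -> oncurve (eopp P).
Proof. by case: P => [[x y]|] //=; rewrite sqrrN. Qed.

Lemma oncurve_add P Q : oncurve P -> oncurve Q -> oncurve (eadd P Q).
Proof.
case: P Q => [[x1 y1]|] [[x2 y2]|] // P Q; rewrite /eadd.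
case: ifPn => // ny.
by have [] := chord_third P (chord_slope P Q ny).
Qed.

Lemma eaddC P Q : oncurve P -> oncurve Q -> eadd P Q = eadd Q P.
Proof.
case: P Q => [[x1 y1]|] [[x2 y2]|] // P Q.
case ny : ((x1 == x2) && (y1 == - y2)).
  have ny' : (x2 == x1) && (y2 == - y1).
    by case/andP: ny => /eqP-> /eqP->; rewrite opprK !eqxx.
  by rewrite /eadd ny ny'.
have ny' : ~~ ((x2 == x1) && (y2 == - y1)).
  apply/negP => /andP[/eqP e /eqP e']; move: ny.
  by rewrite e e' opprK !eqxx.
have c := chord_slope Q P ny'; set l := slope x2 y2 x1 y1 in c.
have [c1 c2] := c.
rewrite (eaddE Q P ny' c) (@eaddE _ _ _ _ l P Q) ?ny //; last first.
  split; first by rewrite -[RHS]opprB -c1; ring.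
  by rewrite addrC c2; ring.
rewrite /third; congr (Some (_, _)); first by ring.
have -> : y2 = y1 - l * (x1 - x2) by rewrite mulrC c1; ring.
by ring.
Qed.

Lemma eoppD P Q : eopp (eadd P Q) = eadd (eopp P) (eopp Q).
Proof.
case: P Q => [[x1 y1]|] [[x2 y2]|] //=.
rewrite eqr_opp; case: ifP => //= ny.
have -> : slope x1 (- y1) x2 (- y2) = - slope x1 y1 x2 y2.
  rewrite /slope; case: ifP => _; first by rewrite mulrN invrN mulrN.
  by rewrite -mulNr; congr (_ / _); ring.
by congr (Some (_, _)); ring.
Qed.

Lemma eaddNl P : eadd (eopp P) P = None.
Proof. by case: P => [[x y]|] //=; rewrite !eqxx. Qed.

Lemma eaddK P Q : oncurve P -> oncurve Q -> eadd (eadd P Q) (eopp Q) = P.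
Proof.
case: P Q => [[x1 y1]|] [[x2 y2]|] // P Q; last first.
  by rewrite eaddC ?oncurve_add ?oncurve_opp //= !eqxx.
case ny : ((x1 == x2) && (y1 == - y2)).
  by rewrite [eadd (Some _) _]/eadd ny /=; case/andP: ny => /eqP-> /eqP->.
move/negbT: ny => ny; have c := chord_slope P Q ny.
rewrite (eaddE P Q ny c) /third; set l := slope _ _ _ _ in c *.
have [C c' ny'] := chord_third P c.
rewrite (eaddE C (oncurve_opp Q) (negbT ny') c') /third.
by congr (Some (_, _)); ring.
Qed.

Lemma eoppK P : eopp (eopp P) = P.
Proof. by case: P => [[x y]|] //=; rewrite opprK. Qed.

Lemma eadd0 P : eadd P None = P. Proof. by case: P => [[]|]. Qed.

Lemma eaddNK P Q : oncurve P -> oncurve Q -> eadd (eadd P (eopp Q)) Q = P.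
Proof.
by move=> P0 Q0; rewrite -{2}(eoppK Q); apply: eaddK => //; apply: oncurve_opp.
Qed.

Lemma eaddA_generic x1 y1 x2 y2 x3 y3
    (A := Some (x1, y1)) (B := Some (x2, y2)) (C := Some (x3, y3)) :
  oncurve A -> oncurve B -> oncurve C ->
  A <> eopp B -> B <> eopp C -> eadd A B <> eopp C -> A <> eopp (eadd B C) ->
  x1 <> x3 -> eadd (eadd A B) C = eadd A (eadd B C).
Proof.
move=> cA cB cC.
have opp_cond x y x' y' : Some (x, y) <> eopp (Some (x', y')) ->
    ~~ ((x == x') && (y == - y')).
  by move=> ne; apply/negP => /andP[/eqP e1 /eqP e2]; apply: ne; rewrite e1 e2.
move=> /opp_cond nAB /opp_cond nBC.
have l_ := chord_slope cA cB nAB; have m_ := chord_slope cB cC nBC.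
set l := slope _ _ _ _ in l_; set m := slope _ _ _ _ in m_.
have cD := oncurve_add cA cB; have cE := oncurve_add cB cC.
move: cD cE; rewrite (eaddE cA cB nAB l_) (eaddE cB cC nBC m_) /third.
set xD := _ - _ - x2; set yD := _ - y1; set xE := _ - _ - x3; set yE := _ - y2.
move=> cD cE /opp_cond nDC /opp_cond nAE n13.
have n_ := chord_slope cD cC nDC; have r_ := chord_slope cA cE nAE.
set n := slope _ _ _ _ in n_; set r := slope _ _ _ _ in r_.
rewrite (eaddE cD cC nDC n_) (eaddE cA cE nAE r_) /third.
have ey1 : y1 = y2 + l * (x1 - x2) by case: l_ => + _; rewrite mulrC => e;
  have -> : l * (x1 - x2) = - (l * (x2 - x1)) by [ring]; rewrite e; ring.
have ey3 : y3 = y2 + m * (x3 - x2) by case: m_ => + _; rewrite mulrC => ->; ring.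
have [||||||||||||Hs Hx Hy] := @coreP K (3 * x2 + a) (3 * x2 ^+ 2 + 2 * a * x2 + b) y2
  (x1 - x2) (x3 - x2) l m n r (xD - x2) yD (xE - x2) yE.
- by rewrite /xD; ring.
- by rewrite /yD ey1; ring.
- by rewrite /xE; ring.
- by rewrite /yE; ring.
- exact: two_neq0.
- have -> : x1 - x2 - (x3 - x2) = x1 - x3 by ring.
  by rewrite subr_eq0; apply/eqP.
- case: l_ => _; rewrite ey1 => e.
  transitivity (x1 ^+ 2 + x1 * x2 + x2 ^+ 2 + a * (x1 + x2) + b); first by ring.
  by rewrite -e; ring.
- case: m_ => _; rewrite ey3 => e.
  transitivity (x2 ^+ 2 + x2 * x3 + x3 ^+ 2 + a * (x2 + x3) + b); first by ring.
  by rewrite -e; ring.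
- case: n_ => e _; have -> : xD - x2 - (x3 - x2) = - (x3 - xD) by ring.
  by rewrite mulNr e ey3; ring.
- move=> /addIr eX; case: n_ => _ e.
  have eY : yD = y3.
    move: cD nDC; rewrite eX eqxx /= => cD; case: (oncurve_eqx cD cC) => // ->.
    by rewrite eqxx.
  split; first by rewrite eY.
    apply: contraNneq nDC => y0; rewrite -eY y0 oppr0 eqxx andbT; exact/eqP.
  have -> : 2 * yD * n = (yD + y3) * n by rewrite eY; ring.
  by rewrite e eX; ring.
- case: r_ => e _; have -> : xE - x2 - (x1 - x2) = xE - x1 by ring.
  by rewrite e ey1; ring.
- move=> /addIr eX; case: r_ => _ e.
  have eY : yE = y1.
    move: cE nAE; rewrite eX eqxx /= => cE; case: (oncurve_eqx cE cA) => // ->.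
    by rewrite opprK eqxx.
  split; first by rewrite eY.
    apply: contraNneq nAE => y0; rewrite -eY y0 oppr0 eqxx andbT eX; exact/eqP.
  have -> : 2 * yE * r = (y1 + yE) * r by rewrite eY; ring.
  by rewrite e eX; ring.
have Hx' : n ^+ 2 - a - xD - x3 = r ^+ 2 - a - x1 - xE.
  transitivity (n ^+ 2 - (xD - x2) - (x3 - x2) - 2 * x2 - a); first by ring.
  by rewrite Hx; ring.
rewrite -Hx'; set xF := _ - x3 in Hx' *; congr (Some (_, _)).
rewrite -ey1 in Hy; rewrite {2}Hx'.
transitivity (n * (xD - x2 - (n ^+ 2 - (3 * x2 + a) - (xD - x2) - (x3 - x2))) - yD).
  by rewrite /xF; ring.
by rewrite Hy; ring.
Qed.

Lemma eaddA P Q R : oncurve P -> oncurve Q -> oncurve R ->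
  eadd (eadd P Q) R = eadd P (eadd Q R).
Proof.
case: R => [[x3 y3]|]; last by rewrite !eadd0.
case: Q => [[x2 y2]|]; last by rewrite eadd0.
case: P => [[x1 y1]|] //.
set A := Some (x1, y1); set B := Some (x2, y2); set C := Some (x3, y3).
move=> cA cB cC; have cAB := oncurve_add cA cB; have cBC := oncurve_add cB cC.
have cN := @oncurve_opp.
have [e|nAB] := eqVneq A (eopp B).
  rewrite e [X in eadd X C]eaddNl [eadd None C]/=.
  rewrite (eaddC (cN _ cB)) // (eaddC cB) // eaddK //.
have [e|nBC] := eqVneq B (eopp C).
  by rewrite e eaddNK // eaddNl eadd0.
have [e|nDC] := eqVneq (eadd A B) (eopp C).
  rewrite e eaddNl -(eoppK C) -e eoppD (eaddC cB) -?eoppD ?cN //.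
  by rewrite eoppD eaddNK ?cN // eaddC ?cN // eaddNl.
have [e|nAE] := eqVneq A (eopp (eadd B C)).
  rewrite {2}e eaddNl e eoppD (eaddC (cN _ cB)) ?cN // eaddNK ?cN //.
  by rewrite eaddNl.
have [e|n13] := eqVneq x1 x3.
  move: (cA) cC; rewrite /A /C -e => cA' cC.
  case: (oncurve_eqx cA' cC) => e'.
    by rewrite -e' (eaddC cB) // eaddC //; apply: oncurve_add.
  have eC : Some (x1, y3) = eopp A by rewrite /A /= e' opprK.
  rewrite eC (eaddC cA) // eaddK // (eaddC cA) ?eaddNK //.
  by apply: oncurve_add => //; apply: cN.
by apply: eaddA_generic => //; apply/eqP.
Qed.

Record point := Point { point_val : option (K * K); point_on : oncurve point_val }.

HB.instance Definition _ := [isSub for point_val].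
HB.instance Definition _ := [Choice of point by <:].

Definition point0 : point := @Point None isT.
Definition point_opp (P : point) : point := Point (oncurve_opp (point_on P)).
Definition point_add (P Q : point) : point :=
  Point (oncurve_add (point_on P) (point_on Q)).

Lemma point_addA : associative point_add.
Proof.
by move=> P Q R; apply: val_inj; rewrite /= eaddA //; apply: point_on.
Qed.

Lemma point_addC : commutative point_add.
Proof. by move=> P Q; apply: val_inj; apply: eaddC; apply: point_on. Qed.

Lemma point_add0 : left_id point0 point_add.
Proof. by move=> P; apply: val_inj. Qed.

Lemma point_addN : left_inverse point0 point_opp point_add.
Proof. by move=> P; apply: val_inj; apply: eaddNl. Qed.

HB.instance Definition _ :=
  GRing.isZmodule.Build point point_addA point_addC point_add0 point_addN.

End GroupLaw.

Definition int_free (G : zmodType) (n : nat) (v : 'I_n -> G) : Prop :=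
  forall c : 'I_n -> int, \sum_i v i *~ c i = 0 -> forall i, c i = 0.

(* r is the dimension of the Q-vector space G (x) Q; a relation, since G need
   not have finite rank. *)
Definition has_rank (G : zmodType) (r : nat) : Prop :=
  (exists v : 'I_r -> G, int_free v) /\
  (forall n (v : 'I_n -> G), int_free v -> (n <= r)%N).

Lemma twist_disc_neq0 (K : fieldType) (E : ecurve K) (d : K) : d != 0 ->
  16 * (coef_b E * d ^+ 2) ^+ 2 *
    ((coef_a E * d) ^+ 2 - 4 * (coef_b E * d ^+ 2)) != 0.
Proof.
move=> d0.
have -> : 16 * (coef_b E * d ^+ 2) ^+ 2 *
    ((coef_a E * d) ^+ 2 - 4 * (coef_b E * d ^+ 2)) =
  16 * coef_b E ^+ 2 * (coef_a E ^+ 2 - 4 * coef_b E) * d ^+ 6 by ring.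
exact: (mulf_neq0 (disc_neq0 E) (expf_neq0 6 d0)).
Qed.

Definition twist (K : fieldType) (E : ecurve K) (d : K) (d0 : d != 0) :
  ecurve K :=
  @ECurve K (coef_a E * d) (coef_b E * d ^+ 2) (twist_disc_neq0 E d0).
Arguments twist {K} E d d0.

Lemma X1_15_disc_neq0 : 16 * 16 ^+ 2 * ((- 7) ^+ 2 - 4 * 16) != 0 :> rat.
Proof. by []. Qed.

(* The Weierstrass model y^2 = x^3 - 7 x^2 + 16 x of the modular curve X_1(15). *)
Definition X1_15 : ecurve rat := @ECurve rat (- 7) 16 X1_15_disc_neq0.

Lemma prime_natr_neq0 (p : nat) : prime p -> p%:R != 0 :> rat.
Proof. by move=> /prime_gt0; rewrite Num.Theory.pnatr_eq0 -lt0n. Qed.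

Lemma prime_neg15_neq0 (p : nat) : prime p -> - (15 * p%:R) != 0 :> rat.
Proof.
by move=> hp; rewrite oppr_eq0 mulf_neq0 ?(prime_natr_neq0 hp).
Qed.

(* The Legendre symbol (a / q), for q an odd prime. *)
Definition legendre (a : int) (q : nat) : int :=
  if (q%:Z %| a)%Z then 0
  else if [exists x : 'I_q, (x%:Z ^+ 2 == a %[mod q%:Z])%Z] then 1 else -1.

(* Main.v *)
Require Import Defs.
From mathcomp Require Import all_boot all_order all_algebra.
From mathcomp Require Import all_fingroup all_solvable all_field.
From mathcomp Require Import ring zify.
Import Order.TTheory GRing.Theory Num.Theory.
Local Open Scope ring_scope.

(* Write D = c p with c = 1 or c = -15, and E for the twist
   y^2 = x^3 - 7 D x^2 + 16 D^2 x.  It has a 2-isogeny to the curve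
   y^2 = x (x - D) (x + 15 D), and the two descents are as follows.

   On E every abscissa is a square: if x = D u / v in lowest terms, then
   Q = u^2 - 7 u v + 16 v^2 is a square up to a factor dividing 2 p, since
   4 Q = (2 u - 7 v)^2 + 15 v^2 prevents 3 and 5 from dividing it; reduction
   modulo 3 and modulo powers of 2 leaves only the factor 1.

   On the isogenous curve every abscissa is 1, -15, p or -15 p times a square,
   as it is for the 2-torsion points: the other classes are excluded
   p-adically, because -1, -3 and 5 are not squares modulo p, and 2-adically.

   Consequently every point P of E satisfies 2 P = 4 R for some R.  The
   abscissas of P and R are squares s^2 and z^2, and comparing numerators and
   denominators yields H(z)^4 <= K H(s)^2 for a constant K.  The successive
   points R thus have bounded height, two of them agree up to sign, and P is a
   torsion point. *)

(** * Squares and divisibility *)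

Lemma square_even_logn (n : nat) : (0 < n)%N ->
  (forall q, prime q -> ~~ odd (logn q n)) -> exists m, n = (m ^ 2)%N.
Proof.
move=> n0 ev; exists (\prod_(q <- primes n) q ^ (logn q n)./2)%N.
rewrite {1}(prod_prime_decomp n0) prime_decompE big_map -[RHS]mulnn -big_split.
rewrite !big_seq; apply: eq_bigr => q; rewrite mem_primes => /andP[q_pr _] /=.
by rewrite -expnD addnn -[in LHS](odd_double_half (logn q n)) (negPf (ev q q_pr)).
Qed.

(** The square of the denominator divides that of the numerator, so coprimality makes the
    denominator a unit. This is how rational points are turned into integral equations. *)
Lemma intr_square (n : int) (r : rat) : n%:~R = r ^+ 2 ->
  exists2 m : int, n = m ^+ 2 & r = m%:~R.
Proof.
move=> e; have d0 := denq_neq0 r.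
have e1 : n * denq r ^+ 2 = numq r ^+ 2.
  apply: (@intr_inj rat); rewrite rmorphM !rmorphXn /= e numqE.
  by rewrite exprMn.
have: (denq r ^+ 2 %| numq r ^+ 2)%Z by rewrite -e1 dvdz_mull.
rewrite dvdz_pexp2r // => dvd.
have r1 : r = (numq r)%:~R.
  have: `|denq r|%N = 1%N.
    apply/eqP; rewrite -dvdn1 -(eqnP (coprime_num_den r)) dvdn_gcd dvdnn andbT.
    by rewrite -dvdzE.
  move=> h; have: denq r = 1 by have := denq_gt0 r; lia.
  by move=> d1; rewrite numqE d1 mulr1.
exists (numq r) => //; apply: (@intr_inj rat).
by rewrite e {1}r1 rmorphXn.
Qed.

Lemma square_quotient (a b c : int) : b != 0 -> a * b ^+ 2 = c ^+ 2 ->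
  exists w, a = w ^+ 2.
Proof.
move=> b0 e; have [|w -> _] := @intr_square a (c%:~R / b%:~R); last by exists w.
have b1 : b%:~R != 0 :> rat by rewrite intr_eq0.
by apply: (mulIf (expf_neq0 2 b1)); rewrite exprMn exprVn divfK ?expf_neq0 //
  -!rmorphXn -rmorphM e.
Qed.

(** Induction on [r]: multiplying [n] by [q] when its exponent of [q] is odd makes that exponent
    even and leaves the exponents of all other primes unchanged. *)
Lemma square_class (r : seq nat) (n : nat) : (0 < n)%N -> all prime r -> uniq r ->
  (forall q, prime q -> q \notin r -> ~~ odd (logn q n)) ->
  exists m, ((\prod_(q <- r) q ^ odd (logn q n)) * n = m ^ 2)%N.
Proof.
move=> n0; elim: r => [|q r IH] in n n0 *.
  move=> _ _ ev; rewrite big_nil mul1n; apply: square_even_logn => // q q_pr.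
  exact: ev.
move=> /= /andP[q_pr r_pr] /andP[qr r_uniq] ev.
have q0 := prime_gt0 q_pr.
have n1 : (0 < q ^ odd (logn q n) * n)%N by rewrite muln_gt0 expn_gt0 q0.
have lE q' : prime q' -> q' != q -> logn q' (q ^ odd (logn q n) * n) = logn q' n.
  move=> q'_pr ne; rewrite lognM ?expn_gt0 ?q0 // lognX (logn_prime q' q_pr).
  by rewrite (negPf ne) muln0.
have [//|//||m em] := IH _ n1.
  move=> q' q'_pr q'r; have [->|ne] := eqVneq q' q.
    by rewrite lognM ?expn_gt0 ?q0 // pfactorK // oddD oddb addbb.
  by rewrite lE // ev // inE negb_or ne.
exists m; rewrite -em big_cons mulnAC [RHS]mulnC; congr (_ * _)%N.
apply: eq_big_seq => q' q'r; rewrite lE ?(allP r_pr) //.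
by apply: contraNneq qr => <-.
Qed.

Lemma prime_dvdzM (q : nat) (a b : int) : prime q ->
  (q %| a * b)%Z = (q %| a)%Z || (q %| b)%Z.
Proof. by move=> q_pr; rewrite !dvdzE abszM Euclid_dvdM. Qed.

Lemma prime_dvdzX (q : nat) (a : int) : prime q -> (q %| a ^+ 2)%Z = (q %| a)%Z.
Proof. by move=> q_pr; rewrite expr2 prime_dvdzM // orbb. Qed.

Lemma logn_abszM q (a b : int) : a != 0 -> b != 0 ->
  logn q `|a * b| = (logn q `|a| + logn q `|b|)%N.
Proof. by move=> a0 b0; rewrite abszM lognM ?absz_gt0. Qed.

Lemma logn_ndvdz (q : nat) (a : int) : ~~ (q %| a)%Z -> logn q `|a| = 0%N.
Proof. by move=> qa; rewrite lognE -[(q %| `|a|)%N]/(q%:Z %| a)%Z (negPf qa) !andbF. Qed.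

Lemma odd_logn_sqr q (a : int) : odd (logn q `|a ^+ 2|) = false.
Proof. by rewrite abszX lognX oddM. Qed.

Lemma prime_ndvd_prime (q a : nat) : prime q -> prime a -> q != a -> ~~ (q %| a%:Z)%Z.
Proof. by move=> q_pr a_pr; rewrite dvdzE /= dvdn_prime2. Qed.

(** * Residues *)

Section ModularEnumeration.
Variable n : nat.

(** The quantifier runs over a list of naturals so that [vm_compute] can decide it. *)
Definition Zall (P : pred 'Z_n) := all (fun i => P (inZp i)) (iota 0 (Zp_trunc n).+2).

Lemma ZallP (P : pred 'Z_n) : Zall P -> forall x, P x.
Proof.
move=> /allP h x; have := h (val x); rewrite valZpK; apply.
by rewrite mem_iota ltn_ord.
Qed.

Lemma Zall2P (P : 'Z_n -> pred 'Z_n) : Zall (fun x => Zall (P x)) ->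
  forall x y, P x y.
Proof. by move=> /ZallP h x; exact: ZallP (h x). Qed.

Lemma Zall3P (P : 'Z_n -> 'Z_n -> pred 'Z_n) :
  Zall (fun x => Zall (fun y => Zall (P x y))) -> forall x y z, P x y z.
Proof. by move=> /ZallP h x; exact: Zall2P (h x). Qed.
End ModularEnumeration.

Definition intr_morphE := (rmorphB, rmorphD, rmorphN, rmorphM, rmorphXn, rmorph1,
  rmorph_nat).

Lemma Z_intr_eq0 (n : nat) (m : int) : (1 < n)%N ->
  (m%:~R == 0 :> 'Z_n) = (n %| m)%Z.
Proof.
move=> n1; rewrite dvdzE /=.
have h (k : nat) : (k%:R == 0 :> 'Z_n) = (n %| k)%N.
  by rewrite -val_eqE /= val_Zp_nat.
by case: m => m /=; rewrite ?NegzE ?mulrNz ?oppr_eq0 -pmulrn h.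
Qed.

Lemma Z_intr_mod (n : nat) (a b : int) : (1 < n)%N -> (a %% n = b %% n)%Z ->
  a%:~R = b%:~R :> 'Z_n.
Proof.
move=> n1 e; apply/eqP; rewrite -subr_eq0 -rmorphB Z_intr_eq0 //.
by rewrite -eqz_mod_dvd; apply/eqP.
Qed.

(** Expresses oddness as an equation in ['Z_8], so that it can enter the finite enumerations. *)
Lemma Z8_odd (u : int) : ~~ (2 %| u)%Z -> 4 * u%:~R == 4 :> 'Z_8.
Proof.
move=> u_odd; have -> : u = 2 * (u %/ 2)%Z + 1 by lia.
by rewrite !intr_morphE /=; move: ((u %/ 2)%Z%:~R); apply: ZallP; vm_compute.
Qed.

Lemma coprimez_prime (q : nat) (u v : int) : coprimez u v -> prime q ->
  (q %| u)%Z -> (q %| v)%Z -> False.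
Proof.
move=> /eqP uv q_pr qu qv; have : (q %| gcdz u v)%Z by rewrite dvdz_gcd qu.
by rewrite uv dvdzE /= dvdn1; apply/negP; have := prime_gt1 q_pr; lia.
Qed.

(** A form of discriminant -15: for [x = D u / v], the factor [x^2 - 7 D x + 16 D^2] of the cubic
    equals [D^2 quad u v / v^2]. *)
Definition quad (u v : int) := u ^+ 2 - 7 * (u * v) + 16 * v ^+ 2.

Lemma legendre5 (p : nat) : legendre p%:Z 5 = -1 ->
  (p %% 5 = 2)%N \/ (p %% 5 = 3)%N.
Proof.
rewrite /legendre; case: ifP => // n0; case: ifP => // /negbT/existsPn nsq _.
have h (i : 'I_5) : (p %% 5 <> i ^ 2 %% 5)%N.
  by move=> e; have /eqP := nsq i; apply; lia.
have := h (@Ordinal 5 0 isT); have := h (@Ordinal 5 1 isT).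
by have := h (@Ordinal 5 2 isT); rewrite /=; lia.
Qed.

(** * The quadratic character modulo a prime *)

Lemma Fp_intr_eq0 (p : nat) (n : int) : prime p ->
  (n%:~R == 0 :> 'F_p) = (p %| n)%Z.
Proof.
move=> p_pr; rewrite dvdzE /= (dvdn_pcharf (pchar_Fp p_pr)).
by case: n => n //=; rewrite NegzE mulrNz oppr_eq0 -pmulrn.
Qed.

(** The Legendre symbol in the form of Euler's criterion; keeping its values in ['F_p] makes
    multiplicativity immediate. *)
Definition chi (p : nat) (n : int) : 'F_p := n%:~R ^+ (p.-1)./2.

Lemma chiM p (m n : int) : chi p (m * n) = chi p m * chi p n.
Proof. by rewrite /chi rmorphM exprMn. Qed.

Lemma Fp_exp (p : nat) (x : 'F_p) : prime p -> x ^+ p = x.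
Proof. by move=> p_pr; have := expf_card x; rewrite card_Fp. Qed.

Lemma chi_sqr p (m : int) : prime p -> odd p -> ~~ (p %| m)%Z -> chi p (m ^+ 2) = 1.
Proof.
move=> p_pr p_odd; rewrite -Fp_intr_eq0 // /chi rmorphXn -exprM => m0.
have p0 := prime_gt0 p_pr.
have -> : (2 * (p.-1)./2 = p.-1)%N by lia.
by apply: (mulIf m0); rewrite -exprSr prednK // Fp_exp // mul1r.
Qed.

Lemma chi_nonresidue p (n : int) : prime p -> (p %% 4 = 3)%N ->
  (forall y : 'F_p, y ^+ 2 <> n%:~R) -> chi p n = -1.
Proof.
move=> p_pr p3 nsq; have n0 : n%:~R != 0 :> 'F_p.
  by apply/eqP => e; apply: (nsq 0); rewrite e expr0n.
have p0 := prime_gt0 p_pr.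
have /eqP : chi p n ^+ 2 = 1.
  apply: (mulIf n0); rewrite /chi -exprM -exprSr mul1r.
  by have -> : ((p.-1)./2 * 2).+1 = p by [lia]; rewrite Fp_exp.
rewrite sqrf_eq1 => /orP[/eqP e|/eqP //].
(* As p = 3 modulo 4, n^((p-1)/2) = 1 makes n^((p+1)/4) a square root of n. *)
case: (nsq (n%:~R ^+ (p.+1 %/ 4)%N)); rewrite -exprM.
have -> : (p.+1 %/ 4 * 2 = (p.-1)./2.+1)%N by lia.
by rewrite exprS -/(chi p n) e mulr1.
Qed.

Lemma chi_eqmod p (a b : int) : prime p -> (p %| a - b)%Z -> chi p a = chi p b.
Proof.
move=> p_pr; rewrite -Fp_intr_eq0 // rmorphB subr_eq0 => /eqP e.
by rewrite /chi e.
Qed.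

(** If [u] or [v] is even, it is divisible by 4, and modulo 8 the second equation makes [7 e] times
    an odd square a square. If both are odd, [u = v + 2 z] turns the second product into
    [4 z (z + 8 v)], and the first equation fixes the power of 2 in [z]; removing it leaves a
    non-square modulo 8. *)
Lemma dyadic (d e u v m w : int) : coprimez u v ->
  (d %% 8 = 7)%Z -> (e %% 8 = 3)%Z \/ (e %% 8 = 5)%Z ->
  e * (u * v) = m ^+ 2 -> d * e * ((u - v) * (u + 15 * v)) = w ^+ 2 -> False.
Proof.
move=> uv d8 e8 em ew.
have dE : d%:~R = 7 :> 'Z_8 by apply: (Z_intr_mod 8 d 7).
have eE : e%:~R = 3 :> 'Z_8 \/ e%:~R = 5 :> 'Z_8.
  by case: e8 => ?; [left; apply: (Z_intr_mod 8 e 3)|right; apply: (Z_intr_mod 8 e 5)].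
have e_odd : ~~ (2 %| e)%Z by case: e8; lia.
have four (x y : int) : e * (x * y) = m ^+ 2 -> (2 %| x)%Z -> ~~ (2 %| y)%Z ->
    exists x', x = 4 * x'.
  move=> e1 /dvdzP[x1 ex] y_odd.
  have : (2 %| m)%Z.
    have e2 : e * (x * y) = e * (x1 * y) * 2 by rewrite ex; ring.
    by rewrite -(@prime_dvdzX 2) // -e1 e2 dvdz_mull.
  case/dvdzP => m1 em1; have : (2 %| e * (x1 * y))%Z.
    have -> : e * (x1 * y) = 2 * m1 ^+ 2.
      by apply: (@mulfI _ 2) => //; transitivity (m ^+ 2); [rewrite -e1 ex;
      ring | rewrite em1; ring].
    by rewrite dvdz_mulr.
  rewrite !(@prime_dvdzM 2) // (negPf e_odd) (negPf y_odd) orbF => /dvdzP[x' ex'].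
  by exists x'; rewrite ex ex'; ring.
have [u_even|u_odd] := boolP (2 %| u)%Z.
  have v_odd : ~~ (2 %| v)%Z by apply/negP; apply: coprimez_prime uv _ u_even.
  have [u' eu] := four _ _ em u_even v_odd.
  move: ew (Z8_odd v v_odd) => /(congr1 (fun x : int => x%:~R : 'Z_8)).
  rewrite eu !intr_morphE /= dE => /eqP e2; apply/negP; move: e2; apply/implyP.
  by case: eE => ->; move: (u'%:~R) (v%:~R) (w%:~R); apply: Zall3P; vm_compute.
have [v_even|v_odd] := boolP (2 %| v)%Z.
  have [|v' ev] := four _ _ _ v_even u_odd; first by rewrite [v * u]mulrC.
  move: ew (Z8_odd u u_odd) => /(congr1 (fun x : int => x%:~R : 'Z_8)).
  rewrite ev !intr_morphE /= dE => /eqP e2; apply/negP; move: e2; apply/implyP.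
  by case: eE => ->; move: (u%:~R) (v'%:~R) (w%:~R); apply: Zall3P; vm_compute.
have [z ez] : exists z, u = v + 2 * z by exists ((u - v) %/ 2)%Z; lia.
move: (Z8_odd u u_odd) (Z8_odd v v_odd) => u8 v8.
(* Since [v] is odd, [e (v^2 + 2 z v)] is a square modulo 8 only if [z] is odd for [e = 3], and
   [z = 2] modulo 4 for [e = 5]; the equations in [z] encode these two conditions. *)
have {e8} [[e8 z_odd]|[e8 z_even]] :
    (e%:~R = 3 :> 'Z_8 /\ 4 * z%:~R == 4 :> 'Z_8) \/
    (e%:~R = 5 :> 'Z_8 /\ 2 * z%:~R == 4 :> 'Z_8).
  move/(congr1 (fun x : int => x%:~R : 'Z_8)): em.
  rewrite ez !intr_morphE /= => /eqP e2; case: eE => ee; [left|right]; split=> //;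
    move: v8; apply/implyP; move: e2; apply/implyP; rewrite ee;
    move: (z%:~R) (v%:~R) (m%:~R); apply: Zall3P; by vm_compute.
  have [||w' /(congr1 (fun x : int => x%:~R : 'Z_8))] := @square_quotient (d * e * (z *
    (z + 8 * v))) 2 w; first by [].
    by rewrite -ew ez; ring.
  rewrite !intr_morphE /= dE e8 => /eqP; apply/negP; move: z_odd; apply/implyP.
  by move: (z%:~R) (v%:~R) (w'%:~R); apply: Zall3P; vm_compute.
have [t et] : exists t, z = 2 * t.
  exists (z %/ 2)%Z; suff: (8 %| 4 * z)%Z by lia.
  rewrite -(@Z_intr_eq0 8) // rmorphM /=.
  by move: z_even; apply/implyP; move: (z%:~R); apply: ZallP; vm_compute.
have [||w' /(congr1 (fun x : int => x%:~R : 'Z_8))] := @square_quotient (d * e * (t *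
  (t + 4 * v))) 4 w; first by [].
  by rewrite -ew ez et; ring.
move: z_even; rewrite et !intr_morphE /= dE e8 => t_odd /eqP; apply/negP; move: v8;
  apply/implyP.
move: t_odd; apply/implyP.
by move: (t%:~R) (v%:~R) (w'%:~R); apply: Zall3P; vm_compute.
Qed.

(** * Heights *)

Lemma absz_sqr_lt (n L : int) : n ^+ 2 <= L -> (`|n| < `|L|.+1)%N.
Proof. by nia. Qed.

(** Bounds the square of the height of [s], which is the height of the abscissa [s^2]. *)
Definition height_le (L : int) (s : rat) := numq s ^+ 2 <= L /\ denq s ^+ 2 <= L.

Lemma numq_denq_dvd (a b : int) : b != 0 ->
  (numq (a%:~R / b%:~R) %| a)%Z /\ (denq (a%:~R / b%:~R) %| b)%Z.
Proof.
move=> b0; set x := _ / _.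
have e : numq x * b = a * denq x.
  apply: (@intr_inj rat); rewrite !rmorphM /= numqE -mulrA [_ * b%:~R]mulrC mulrA.
  by rewrite /x divfK ?intr_eq0.
have cop : coprimez (numq x) (denq x) := coprime_num_den x.
split; first by rewrite -(Gauss_dvdzl _ cop) -e dvdz_mulr.
by rewrite -(@Gauss_dvdzr _ (numq x)) ?e ?dvdz_mull // coprimez_sym.
Qed.

Lemma dvdz_sqr_le (a b : int) : b != 0 -> (a %| b)%Z -> a ^+ 2 <= b ^+ 2.
Proof.
move=> b0 /dvdzP[q eb]; rewrite eb exprMn ler_peMl ?sqr_ge0 //.
have : q != 0 by apply: contraNneq b0 => q0; rewrite eb q0 mul0r.
by move=> q0; have : 0 < q ^+ 2 by rewrite lt_def sqrf_eq0 q0 sqr_ge0.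
Qed.

(** Controls translation by the 2-torsion point: if [s^2] is the abscissa of a point of the twist by
    [d], then [(4 d / s)^2] is that of its sum with [(0, 0)]. *)
Lemma height_quotient (L d : int) (s : rat) : d != 0 -> s != 0 -> height_le L s ->
  height_le (16 * d ^+ 2 * L) (4 * d%:~R / s).
Proof.
move=> d0 s0 [numL denL].
have n0 : numq s != 0 by rewrite numq_eq0.
have -> : 4 * d%:~R / s = (4 * d * denq s)%:~R / (numq s)%:~R.
  rewrite !rmorphM /= -{1}(divq_num_den s); field.
  by rewrite !intr_eq0 n0 denq_neq0.
have [h1 h2] := numq_denq_dvd (4 * d * denq s) _ n0.
have d1 : 1 <= d ^+ 2 by have : 0 < d ^+ 2 by [rewrite lt_def sqrf_eq0 d0 sqr_ge0]; lia.
split; first apply: le_trans (dvdz_sqr_le _ _ _ h1) _.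
- by rewrite !mulf_neq0 ?denq_neq0.
- have -> : (4 * d * denq s) ^+ 2 = 16 * d ^+ 2 * denq s ^+ 2 by ring.
  by rewrite ler_wpM2l // mulr_ge0 ?sqr_ge0.
apply: le_trans (dvdz_sqr_le _ _ _ h2) _ => //.
have L0 : 0 <= L := le_trans (sqr_ge0 _) numL.
by rewrite (le_trans numL) // ler_peMl //; lia.
Qed.

(** With [s = A / B] and [z = M / e], the numbers [C = t B] and [N = t M e] are integers. Here [C^2]
    is linear in [L], [N^2] divides [(4 d C)^2], and [M^4] and [e^4] are bounded by [N^2], a
    definite form in [M^2] and [e^2]. So the fourth powers for the half are bounded linearly in
    [L]. *)
Lemma height_half (L d : int) (s w t z : rat) : d != 0 -> height_le L s ->
  w ^+ 2 = s ^+ 4 - 7 * d%:~R * s ^+ 2 + 16 * d%:~R ^+ 2 ->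
  t ^+ 2 = 2 * s ^+ 2 - 7 * d%:~R + 2 * w -> t != 0 -> z != 0 ->
  t ^+ 2 = z ^+ 2 - 7 * d%:~R + 16 * d%:~R ^+ 2 / z ^+ 2 ->
  numq z ^+ 4 <= 64 * 16 * 19 * `|d| ^+ 3 * L /\
    denq z ^+ 4 <= 64 * 16 * 19 * `|d| ^+ 3 * L.
Proof.
move=> d0 [AL BL] ew et t0 z0 ez.
have sE := divq_num_den s; have zE := divq_num_den z.
set A := numq s in AL sE; set B := denq s in BL sE.
have cop : coprimez (numq z) (denq z) := coprime_num_den z.
have M0 : numq z != 0 by rewrite numq_eq0.
have e0 : denq z != 0 := denq_neq0 z.
set M := numq z in cop M0 zE *; set e := denq z in cop e0 zE *.
have B0 : B != 0 := denq_neq0 s.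
have Br0 : B%:~R != 0 :> rat by rewrite intr_eq0.
have er0 : e%:~R != 0 :> rat by rewrite intr_eq0.
have Mr0 : M%:~R != 0 :> rat by rewrite intr_eq0.
have [|n en wn] := intr_square (A ^+ 4 - 7 * d * A ^+ 2 * B ^+ 2 + 16 * d ^+ 2 * B ^+
  4) (w * B%:~R ^+ 2).
  by rewrite exprMn ew -sE !intr_morphE /=; field.
have [|C eC tC] := intr_square (2 * A ^+ 2 - 7 * d * B ^+ 2 + 2 * n) (t * B%:~R).
  by rewrite exprMn et !intr_morphE /= -wn -sE; field.
have [|N eN tN] := intr_square (M ^+ 4 - 7 * d * M ^+ 2 * e ^+ 2 + 16 * d ^+ 2 * e ^+
  4) (t * M%:~R * e%:~R).
  by rewrite !exprMn ez -zE !intr_morphE /=; field; rewrite er0.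
have NB : N * B = C * M * e.
  by apply: (@intr_inj rat); rewrite !rmorphM /= -tN -tC; ring.
have C0 : C != 0 by rewrite -(intr_eq0 rat) -tC mulf_neq0.
have copN : coprimez (N ^+ 2) (e ^+ 6).
  rewrite coprimezXr // coprimez_sym /coprimez -eN.
  have -> : M ^+ 4 - 7 * d * M ^+ 2 * e ^+ 2 + 16 * d ^+ 2 * e ^+ 4 =
    (16 * d ^+ 2 * e ^+ 3 - 7 * d * M ^+ 2 * e) * e + M ^+ 4 by ring.
  by rewrite gcdzMDl -/(coprimez _ _) coprimezXr // coprimez_sym.
(* The formula for [N^2] gives [16 d^2 e^4 = - M^2 (M^2 - 7 d e^2)] modulo [N^2], while
   [C^2 M^2 e^2 = N^2 B^2]. Hence [N^2] divides [(4 d C)^2 e^6], and [e] is prime to [N]. *)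
have Ndvd : (N ^+ 2 %| (4 * d * C) ^+ 2)%Z.
  rewrite -(Gauss_dvdzr _ copN).
  apply/dvdzP; exists (C ^+ 2 * e ^+ 2 - B ^+ 2 * (M ^+ 2 - 7 * d * e ^+ 2)).
  transitivity (C ^+ 2 * e ^+ 2 * N ^+ 2 - (N * B) ^+ 2 * (M ^+ 2 - 7 * d * e ^+ 2));
    last by ring.
  by rewrite NB -eN; ring.
have N2 : N ^+ 2 <= (4 * d * C) ^+ 2.
  by apply: dvdz_sqr_le; [rewrite !mulf_neq0|rewrite -(@dvdz_pexp2r _ _ 2)].
have D1 : 1 <= `|d| by rewrite -gtz0_ge1 normr_gt0.
have dD : d ^+ 2 = `|d| ^+ 2 by rewrite real_normK ?num_real.
have dle : - d <= `|d| by rewrite -normrN ler_norm.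
have L0 : 0 <= L by apply: le_trans AL; apply: sqr_ge0.
(* Completing the square shows that 64 suffices, both here and for [e]. *)
have M4 : M ^+ 4 <= 64 * N ^+ 2.
  rewrite -eN -subr_ge0.
  have -> : 64 * (M ^+ 4 - 7 * d * M ^+ 2 * e ^+ 2 + 16 * d ^+ 2 * e ^+ 4) - M ^+ 4 =
    14 * (M ^+ 2) ^+ 2 + (7 * M ^+ 2 - 32 * d * e ^+ 2) ^+ 2 by ring.
  by rewrite addr_ge0 ?sqr_ge0 // mulr_ge0 ?sqr_ge0.
have e4 : e ^+ 4 <= 64 * N ^+ 2.
  apply: (@le_trans _ _ (d ^+ 2 * e ^+ 4)).
    by rewrite ler_peMl ?exprn_even_ge0 // dD expr_ge1 // le_trans D1.
  rewrite -eN -subr_ge0.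
  have -> : 64 * (M ^+ 4 - 7 * d * M ^+ 2 * e ^+ 2 + 16 * d ^+ 2 * e ^+ 4) - d ^+ 2 * e
    ^+ 4 =
    16 * (2 * M ^+ 2 - 7 * d * e ^+ 2) ^+ 2 + 239 * (d * e ^+ 2) ^+ 2 by ring.
  by rewrite addr_ge0 ?sqr_ge0 // mulr_ge0 ?sqr_ge0.
have A0 := sqr_ge0 A; have B0' := sqr_ge0 B.
(* The coefficients of [n^2] add up to [1 + 7 + 16 = 24], which is below [5^2]. *)
have nL : n <= 5 * `|d| * L.
  apply: le_trans (ler_norm _) _; rewrite -(@ler_pXn2r _ 2) ?nnegrE ?mulr_ge0 //.
  rewrite real_normK ?num_real // -en.
  have AA : (A ^+ 2) * (A ^+ 2) <= L * L by rewrite ler_pM.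
  have AB : (A ^+ 2) * (B ^+ 2) <= L * L by rewrite ler_pM.
  have BB : (B ^+ 2) * (B ^+ 2) <= L * L by rewrite ler_pM.
  have AB0 : 0 <= (A ^+ 2) * (B ^+ 2) by rewrite mulr_ge0.
  have -> : A ^+ 4 - 7 * d * A ^+ 2 * B ^+ 2 + 16 * d ^+ 2 * B ^+ 4 =
    A ^+ 2 * A ^+ 2 + 7 * (- d * (A ^+ 2 * B ^+ 2)) + 16 * (d ^+ 2 * (B ^+ 2 * B ^+ 2))
    by ring.
  have -> : (5 * `|d| * L) ^+ 2 = 25 * (`|d| ^+ 2 * (L * L)) by ring.
  rewrite dD; have h1 : - d * (A ^+ 2 * B ^+ 2) <= `|d| ^+ 2 * (L * L).
    apply: (@le_trans _ _ (`|d| * (A ^+ 2 * B ^+ 2))); first by rewrite ler_wpM2r.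
    by rewrite ler_pM // expr2 ler_peMr.
  have h2 : `|d| ^+ 2 * (B ^+ 2 * B ^+ 2) <= `|d| ^+ 2 * (L * L).
    by rewrite ler_wpM2l ?exprn_ge0.
  have h3 : A ^+ 2 * A ^+ 2 <= `|d| ^+ 2 * (L * L).
    by rewrite (le_trans AA) // ler_peMl ?mulr_ge0 // expr_ge1.
  by clear -h1 h2 h3; lia.
(* Here 19 is [2 + 7 + 2 * 5], the last term coming from [n]. *)
have C2 : C ^+ 2 <= 19 * `|d| * L.
  rewrite -eC; have h : - d * B ^+ 2 <= `|d| * L.
    apply: (@le_trans _ _ (`|d| * B ^+ 2)); first by rewrite ler_wpM2r.
    by rewrite ler_wpM2l.
  have hA : A ^+ 2 <= `|d| * L by rewrite (le_trans AL) // ler_peMl.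
  by clear -h hA nL; lia.
suff h : 64 * N ^+ 2 <= 64 * 16 * 19 * `|d| ^+ 3 * L by split; apply: le_trans h.
apply: (@le_trans _ _ (64 * (16 * `|d| ^+ 2 * C ^+ 2))).
  by rewrite ler_wpM2l // (le_trans N2) // -dD le_eqVlt; apply/orP; left; apply/eqP; ring.
have -> : 64 * 16 * 19 * `|d| ^+ 3 * L = 64 * (16 * `|d| ^+ 2 * (19 * `|d| * L)) by ring.
by rewrite !ler_wpM2l // mulr_ge0 // exprn_ge0.
Qed.

(** * Halving points *)

Section Points.
Variables (K : fieldType) (E : ecurve K).
Local Notation a := (coef_a E).
Local Notation b := (coef_b E).

Lemma coef_b_neq0 : b != 0.
Proof. by apply: contraNneq (disc_neq0 E) => ->; apply/eqP; ring. Qed.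

(** Says that [r = s^2 + s t + w] satisfies [r + a + b / r = t^2], which is the condition for
    [(r, r t)] to lie on the curve. *)
Lemma halving_quotient (s w t : K) : w ^+ 2 = s ^+ 4 + a * s ^+ 2 + b ->
  t ^+ 2 = 2 * s ^+ 2 + a + 2 * w ->
  (s ^+ 2 + s * t + w) * (t ^+ 2 - a - (s ^+ 2 + s * t + w)) = b.
Proof.
move=> ew et; have -> : b = w ^+ 2 - s ^+ 4 - a * s ^+ 2 by rewrite ew; ring.
have -> : a = t ^+ 2 - 2 * s ^+ 2 - 2 * w by rewrite et; ring.
by ring.
Qed.

(* The tangent at the half of (s^2, s w) has slope s + t. *)
Lemma halving (s w t : K) (P : point E) : point_val P = Some (s ^+ 2, s * w) ->
  w ^+ 2 = s ^+ 4 + a * s ^+ 2 + b -> t ^+ 2 = 2 * s ^+ 2 + a + 2 * w -> t != 0 ->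
  exists2 R : point E, point_val R = Some (s ^+ 2 + s * t + w, (s ^+ 2 + s * t + w) * t) &
    R + R = P.
Proof.
move=> eP ew et t0; have er := halving_quotient s w t ew et.
set r := s ^+ 2 + s * t + w in er *.
have r0 : r != 0 by apply: contraNneq coef_b_neq0 => r0; rewrite -er r0 mul0r.
have on : oncurve E (Some (r, r * t)) by apply/eqP; rewrite -er; ring.
exists (Point on) => //; apply: val_inj.
rewrite -[LHS]/(eadd E (Some (r, r * t)) (Some (r, r * t))) -[RHS]/(point_val P) eP.
have ny : ~~ ((r == r) && (r * t == - (r * t))).
  rewrite eqxx /= -addr_eq0 -mulr2n -mulr_natl.
  by rewrite !mulf_neq0 ?(two_neq0 E).
have ea : a = t ^+ 2 - 2 * s ^+ 2 - 2 * w by rewrite et; ring.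
have ch : chord E r (r * t) r (r * t) (s + t).
  by split; [ring|rewrite -er ea /r; ring].
rewrite (eaddE on on ny ch) /third; congr (Some (_, _)); rewrite ea /r; ring.
Qed.

Lemma oncurve_00 : oncurve E (Some (0, 0)).
Proof. by apply/eqP; ring. Qed.
Definition point00 : point E := Point oncurve_00.

Lemma point00_2 : point00 + point00 = 0.
Proof. by apply: val_inj; rewrite /= oppr0 eqxx. Qed.

Lemma translate_point00 (x y : K) (P : point E) : point_val P = Some (x, y) -> x != 0 ->
  point_val (P + point00) = Some (b / x, - (b * y / x ^+ 2)).
Proof.
move=> eP x0; have on := point_on P; rewrite eP in on.
have ny : ~~ ((x == 0) && (y == - 0)) by rewrite (negPf x0).
have ch : chord E x y 0 0 (y / x).
  split; first by field.
  have e2 : y ^+ 2 = x ^+ 3 + a * x ^+ 2 + b * x := eqP on.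
  by transitivity (y ^+ 2 / x); [field|rewrite e2; field].
have e2 : y ^+ 2 = x ^+ 3 + a * x ^+ 2 + b * x := eqP on.
rewrite -[LHS]/(eadd E (point_val P) (Some (0, 0))) eP (eaddE on oncurve_00 ny ch) /third.
have ex : (y / x) ^+ 2 - a - x - 0 = b / x by rewrite expr_div_n e2; field.
by rewrite ex; congr (Some (_, _)); transitivity (y * (x ^+ 2 - b) / x ^+ 2 - y); field.
Qed.

Lemma point_eq_opp (P Q : point E) (x y y' : K) :
  point_val P = Some (x, y) -> point_val Q = Some (x, y') -> P = Q \/ P = - Q.
Proof.
move=> eP eQ; have := point_on P; have := point_on Q; rewrite eP eQ => onQ onP.
case: (oncurve_eqx onP onQ) => e; [left|right]; apply: val_inj => /=; by rewrite eP eQ e.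
Qed.

Lemma point_abscissa0 (P : point E) (y : K) : point_val P = Some (0, y) -> P *+ 2 = 0.
Proof.
move=> eP; have := point_on P; rewrite eP => on.
have e2 : y ^+ 2 = 0 ^+ 3 + a * 0 ^+ 2 + b * 0 := eqP on.
have y0 : y = 0 by apply/eqP; rewrite -sqrf_eq0 e2; apply/eqP; ring.
by have -> : P = point00 by [apply: val_inj; rewrite /= eP y0]; rewrite mulr2n point00_2.
Qed.
End Points.

(** * Repeated halving inside a finite set, up to sign *)

Section BoundedOrbit.
Variables (G : zmodType) (T : finType) (S : G -> Prop) (code : G -> T -> Prop).
Hypothesis code_ex : forall P, S P -> exists i, code P i.
Hypothesis code_opp : forall P Q i, code P i -> code Q i -> P = Q \/ P = - Q.
Hypothesis step : forall P, S P -> exists2 R, S R & P *+ 2 = R *+ 4.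

(** A chain of prescribed finite length is enough for the pigeonhole argument, and induction builds
    it without choosing a successor for every point. *)
Lemma orbit_sequence (n : nat) (P : G) : S P -> exists (f : nat -> G) (g : nat -> T),
  [/\ f 0%N = P, forall i, (i < n)%N -> f i *+ 2 = f i.+1 *+ 4 & forall i, (i <= n)%N
    -> code (f i) (g i)].
Proof.
elim: n P => [|n IH] P SP; have [i ci] := code_ex P SP.
  exists (fun=> P), (fun=> i); split=> //.
have [R SR e] := step P SP; have [f [g [f0 fs fg]]] := IH R SR.
exists (fun j => if j is j'.+1 then f j' else P), (fun j =>
  if j is j'.+1 then g j' else i).
split=> // [[|j] hj|[|j] hj] //=; [by rewrite f0|exact: fs|exact: fg].
Qed.

(** Among [#|T| + 1] terms two share a code, so [f i = f j] or [f i = - f j] with [i < j]. As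
    [2 f i = 2^k (2 f j)] for [k = j - i], the point [2 f i] is killed by [2^k - 1] or [2^k + 1],
    and [2 P] is a multiple of [2 f i]. *)
Lemma orbit_torsion (P : G) : S P -> exists2 n, (0 < n)%N & P *+ n = 0.
Proof.
move=> SP; have [f [g [f0 fs fg]]] := orbit_sequence #|T| P SP.
have shift i k : (i + k <= #|T|)%N -> f i *+ 2 = f (i + k)%N *+ 2 *+ 2 ^ k.
  elim: k => [|k IHk] h; first by rewrite addn0.
  have h' : (i + k < #|T|)%N by rewrite -addnS.
  by rewrite IHk ?(ltnW h') // fs // -!mulrnA addnS expnS mulnA.
have /injectivePn[i [j ij gij]] : ~~ injectiveb (fun i : 'I_(#|T|.+1) => g i).
  by apply/negP => /injectiveP /leq_card; rewrite card_ord ltnn.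
wlog lt_ij : i j ij gij / (i < j)%N.
  move=> wl; have := ij; rewrite -val_eqE neq_ltn => /orP[|] h; first exact: wl h.
  by apply: (wl j i) => //; rewrite eq_sym.
have jT : (j <= #|T|)%N by rewrite -ltnS.
have e1 := shift 0%N i; have e2 := shift i (j - i)%N.
rewrite subnKC ?(ltnW lt_ij) // in e2; rewrite add0n f0 in e1.
have {}e1 := e1 (leq_trans (ltnW lt_ij) jT); have {}e2 := e2 jT.
set k := (j - i)%N in e2.
have k0 : (0 < k)%N by rewrite subn_gt0.
have k2 : (2 <= 2 ^ k)%N by rewrite -{1}(expn1 2) leq_exp2l.
have tors n : (0 < n)%N -> f i *+ 2 *+ n = 0 -> exists2 n, (0 < n)%N & P *+ n = 0.
  move=> n0 e; exists (2 * n)%N; first by rewrite muln_gt0.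
  by rewrite mulrnA e1 mulrnAC e mul0rn.
have /code_opp h := fg i (leq_trans (ltnW lt_ij) jT).
have := fg j jT; rewrite -gij => /h [e|e]; move: e2; rewrite e.
  move=> e2; apply: (tors (2 ^ k - 1)%N); first by rewrite subn_gt0.
  by rewrite e mulrnBr ?(leq_trans _ k2) // -e2 mulr1n subrr.
rewrite mulNrn => e2; apply: (tors (2 ^ k + 1)%N); first by rewrite addn1.
by rewrite e mulNrn mulrnDr mulr1n mulNrn -e2 opprK subrr.
Qed.
End BoundedOrbit.

(** * The two descents *)

Section Descent.
Variables (p : nat) (p_pr : prime p).
Hypothesis (p8 : (p %% 8 = 7)%N) (p3 : (p %% 3 = 2)%N).
Hypothesis p5 : (p %% 5 = 2)%N \/ (p %% 5 = 3)%N.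

(** * The quadratic characters of -1, -3 and 5 modulo [p] *)

Lemma p_ndvd (n : nat) : (0 < n < 23)%N -> ~~ (p %| n%:Z)%Z.
Proof.
move=> /andP[n0 n23]; apply/negP => dvd; have : (p <= n)%N by apply: dvdn_leq n0 dvd.
(* The congruences modulo 8 and 3 give [p = 23] modulo 24, hence [p >= 23]. *)
by lia.
Qed.

Lemma p_nat_neq0 (n : nat) : (0 < n < 23)%N -> n%:R != 0 :> 'F_p.
Proof. by move=> hn; rewrite pmulrn Fp_intr_eq0 // p_ndvd. Qed.

Lemma chiN1 : chi p (-1) = -1.
Proof.
rewrite /chi rmorphN -signr_odd.
by have -> : odd (p.-1)./2 by lia.
Qed.

(** From [y^2 = -3] follows [(y - 1)^3 = 8]. As [p = 2] modulo 3, cubing is injective on ['F_p], so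
    [y - 1 = 2] and [12 = y^2 + 3] would vanish. *)
Lemma nonresidueN3 (y : 'F_p) : y ^+ 2 <> (-3)%:~R.
Proof.
move=> ey; have {}ey : y ^+ 2 = -3 by rewrite ey rmorphN.
have w3 : (y - 1) ^+ 3 = 8.
  have -> : (y - 1) ^+ 3 = y * y ^+ 2 - 3 * y ^+ 2 + 3 * y - 1 by ring.
  by rewrite ey; ring.
set w := y - 1 in w3; set k := (p %/ 3)%N.
have pE : (3 * k + 2 = p)%N by lia.
(* Recovers [x] from its cube: both [w] and 2 have cube 8, and both turn out to be inverse to
   [8 ^+ k]. *)
have xp (x : 'F_p) : (x ^+ 3) ^+ k * x ^+ 2 = x by rewrite -exprM -exprD pE Fp_exp.
have w0 : w != 0.
  by apply: contraNneq (p_nat_neq0 8 isT) => e; rewrite -w3 e expr0n.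
have ew : 8 ^+ k * w = 1.
  apply: (mulIf w0); by rewrite mul1r -[RHS]xp w3 expr2 mulrA.
have e2 : 8 ^+ k * 2 = 1 :> 'F_p.
  have n2 := p_nat_neq0 2 isT; apply: (mulIf n2).
  have h8 : (8 : 'F_p) = 2 ^+ 3 by rewrite -natrX.
  by rewrite mul1r -[RHS]xp h8 expr2 mulrA.
have ww : w = 2.
  apply: (mulfI (x := 8 ^+ k)); last by rewrite ew e2.
  by apply: expf_neq0; apply: p_nat_neq0.
have yy : y = 3 by have -> : y = w + 1 by [rewrite /w; ring]; rewrite ww; ring.
have /eqP := p_nat_neq0 12 isT; apply.
have -> : 12%:R = y ^+ 2 + 3 :> 'F_p by rewrite yy; ring.
by rewrite ey; ring.
Qed.

(* The quadratic Gauss sum of a fifth root of unity in the field with p^4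
   elements is a square root of 5 which the Frobenius map negates. *)
Lemma nonresidue5 (y : 'F_p) : y ^+ 2 <> 5%:~R.
Proof.
move=> ey; have [F pF cF] := pPrimePowerField p_pr (isT : 0 < 4)%N.
have : (5 %| #|[set: {unit F}]%G|)%N.
  rewrite card_finField_unit cF.
  have : (p ^ 4 %% 5 = 1)%N by rewrite -modnXm; case: p5 => ->.
  by have := prime_gt0 p_pr; lia.
case/(Cauchy (isT : prime 5)) => u _ ou; pose z : F := val u.
have z5 : z ^+ 5 = 1 by rewrite -FinRing.val_unitX -ou expg_order.
have z1 : z != 1.
  apply/eqP => e; have : u = 1%g by apply: val_inj.
  by move=> u1; move: ou; rewrite u1 order1.
have zs : 1 + z + z ^+ 2 + z ^+ 3 + z ^+ 4 = 0.
  apply: (mulfI (x := z - 1)); first by rewrite subr_eq0.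
  by rewrite mulr0; transitivity (z ^+ 5 - 1); [ring|rewrite z5 subrr].
pose g := z + z ^+ 4 - z ^+ 2 - z ^+ 3.
have g2 : g ^+ 2 = 5.
  have -> : g ^+ 2 = 5 - (1 + z + z ^+ 2 + z ^+ 3 + z ^+ 4)
      + (z ^+ 5 - 1) * (z ^+ 3 - 2 * z ^+ 2 - z + 4) by rewrite /g; ring.
  by rewrite z5 zs; ring.
have gp : g ^+ p = - g.
  have fz : z ^+ p = z ^+ (p %% 5).
    by rewrite {1}(divn_eq p 5) exprD mulnC exprM z5 expr1n mul1r.
  rewrite -(pFrobenius_autE pF) !rmorphB rmorphD !rmorphXn.
  rewrite [_ z](pFrobenius_autE pF) fz.
  apply/eqP; rewrite -addr_eq0 /g; apply/eqP.
  case: p5 => ->; [transitivity ((z ^+ 5 - 1) * (z ^+ 3 - z)) |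
    transitivity ((z ^+ 5 - 1) * (z ^+ 7 + z ^+ 2 - z - z ^+ 4))];
    by [ring | rewrite z5 subrr mul0r].
(* Since [g^2 = 5 = y^2], the sum [g] is plus or minus an element of the prime field, which
   Frobenius fixes. *)
have ng : g ^+ p = g.
  have /eqP : g ^+ 2 = (val y)%:R ^+ 2.
    rewrite g2 -natrX -(GRing.natr_mod_pchar pF (_ ^ _)%N).
    have -> : (val y ^ 2 = 5 %[mod p])%N.
      by rewrite -!(val_Fp_nat p_pr) natrX natr_Zp ey.
    by rewrite (GRing.natr_mod_pchar pF).
  rewrite eqf_sqr => /orP[]/eqP ->; last rewrite -mulN1r exprMn.
    by rewrite -(pFrobenius_autE pF) pFrobenius_aut_nat.
  rewrite -!(pFrobenius_autE pF) pFrobenius_aut_nat rmorphN1.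
  by [].
have n2 : (2 : F) != 0.
  by rewrite -(dvdn_pcharf pF); have := p_ndvd 2 isT.
have : g = 0 by apply: (mulfI n2); rewrite mulr0 mulr2n mulrDl mul1r -{1}ng gp addNr.
move=> g0; have : (p %| 5)%N by rewrite (dvdn_pcharf pF) -g2 g0 expr0n.
by apply/negP; have := p_ndvd 5 isT.
Qed.

Lemma chiN3 : chi p (-3) = -1.
Proof. by apply: chi_nonresidue nonresidueN3; rewrite //; lia. Qed.

Lemma chi5 : chi p 5 = -1.
Proof. by apply: chi_nonresidue nonresidue5; rewrite //; lia. Qed.

(** * Descent on the twist: [quad u v] is a square *)

Section FirstDescent.
Variables (c u v k : int).
Hypotheses (c_def : c = 1 \/ c = -15) (uv : coprimez u v) (u0 : u != 0) (v0 : v != 0).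
Hypothesis ek : c * p%:Z * (u * v) * quad u v = k ^+ 2.

Lemma quad_gt0 : 0 < quad u v.
Proof.
have v2 : 0 < v ^+ 2 by rewrite lt_def sqrf_eq0 v0 sqr_ge0.
have : 4 * quad u v = (2 * u - 7 * v) ^+ 2 + 15 * v ^+ 2 by rewrite /quad; ring.
by have := sqr_ge0 (2 * u - 7 * v); lia.
Qed.

(** Modulo 3 the form is [(u + v)^2], so divisibility gives [u = 3 z - v] and [quad u v = 3 Q'] with
    [Q' = 2 v^2] modulo 3. For [c = 1] the left side of [ek] is then divisible by 3 exactly once;
    for [c = -15], division by 9 leaves the non-square [- v^4] modulo 3. *)
Lemma quad_ndvd3 : ~~ (3 %| quad u v)%Z.
Proof.
apply/negP => dvdQ.
have : (3 %| (u + v) ^+ 2)%Z.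
  have -> : (u + v) ^+ 2 = quad u v + 3 * (3 * u * v - 5 * v ^+ 2) by rewrite /quad; ring.
  by rewrite rpredD // dvdz_mulr.
rewrite (@prime_dvdzX 3) // => /dvdzP[z ez].
have nv : ~~ (3 %| v)%Z.
  by apply/negP => dv; apply: (coprimez_prime 3 u v uv) => //; lia.
have eu : u = 3 * z - v by lia.
have eQ : quad u v = 3 * (3 * z ^+ 2 - 9 * z * v + 8 * v ^+ 2).
  by rewrite /quad eu; ring.
have pZ : (p%:Z%:~R : 'Z_3) = 2 by apply: (Z_intr_mod 3 p%:Z 2); lia.
move: ek nv; rewrite eQ eu -(@Z_intr_eq0 3) //.
case: c_def => -> e.
  have : (3 %| k)%Z.
    by rewrite -(@prime_dvdzX 3) // -e mulrCA dvdz_mulr.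
  case/dvdzP => j ej; move: e; rewrite ej => e.
  have : p%:Z * ((3 * z - v) * v) * (3 * z ^+ 2 - 9 * z * v + 8 * v ^+ 2) = 3 * j ^+ 2.
    by apply: (@mulfI _ 3) => //; transitivity ((j * 3) ^+ 2); [rewrite -e; ring|ring].
  move=> /(congr1 (fun x : int => x%:~R : 'Z_3)); rewrite !intr_morphE /= pZ => /eqP e3.
  apply/negP; move: e3; apply/implyP; move: (z%:~R) (v%:~R) (j%:~R).
  by apply: Zall3P; vm_compute.
have [||w /esym] := @square_quotient (- 5 * p%:Z * ((3 * z - v) * v) *
   (3 * z ^+ 2 - 9 * z * v + 8 * v ^+ 2)) 3 k; first by [].
  by rewrite -e; ring.
move=> /(congr1 (fun x : int => x%:~R : 'Z_3)); rewrite !intr_morphE /= pZ => /eqP e3.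
apply/negP; move: e3; apply/implyP; move: (z%:~R) (v%:~R) (w%:~R).
by apply: Zall3P; vm_compute.
Qed.

(** Modulo 5 the form is [(u - v)^2]. For [c = 1] the left side of [ek] would be divisible by 5
    exactly once; for [c = -15], division by 25 leaves [- p v^4] modulo 5, a non-square because [p]
    is one and -1 is a square. *)
Lemma quad_ndvd5 : ~~ (5 %| quad u v)%Z.
Proof.
apply/negP => dvdQ.
have : (5 %| (u - v) ^+ 2)%Z.
  have -> : (u - v) ^+ 2 = quad u v + 5 * (u * v - 3 * v ^+ 2) by rewrite /quad; ring.
  by rewrite rpredD // dvdz_mulr.
rewrite (@prime_dvdzX 5) // => /dvdzP[z ez].
have nv : ~~ (5 %| v)%Z.
  by apply/negP => dv; apply: (coprimez_prime 5 u v uv) => //; lia.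
have eu : u = v + 5 * z by lia.
have eQ : quad u v = 5 * (2 * v ^+ 2 - 5 * v * z + 5 * z ^+ 2).
  by rewrite /quad eu; ring.
have pZ : (p%:Z%:~R : 'Z_5) = 2 \/ (p%:Z%:~R : 'Z_5) = 3.
  by case: p5 => h; [left; apply: (Z_intr_mod 5 p%:Z 2)|right;
    apply: (Z_intr_mod 5 p%:Z 3)]; lia.
move: ek nv; rewrite eQ eu -(@Z_intr_eq0 5) //.
case: c_def => -> e.
  have : (5 %| k)%Z.
    by rewrite -(@prime_dvdzX 5) // -e mulrCA dvdz_mulr.
  case/dvdzP => j ej; move: e; rewrite ej => e.
  have : p%:Z * ((v + 5 * z) * v) * (2 * v ^+ 2 - 5 * v * z + 5 * z ^+ 2) = 5 * j ^+ 2.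
    by apply: (@mulfI _ 5) => //; transitivity ((j * 5) ^+ 2); [rewrite -e; ring|ring].
  move=> /(congr1 (fun x : int => x%:~R : 'Z_5)); rewrite !intr_morphE /= => /eqP e5.
  apply/negP; move: e5; apply/implyP; move: (z%:~R) (v%:~R) (j%:~R).
  by case: pZ => ->; apply: Zall3P; vm_compute.
have [||w /esym] := @square_quotient (- 3 * p%:Z * ((v + 5 * z) * v) *
   (2 * v ^+ 2 - 5 * v * z + 5 * z ^+ 2)) 5 k; first by [].
  by rewrite -e; ring.
move=> /(congr1 (fun x : int => x%:~R : 'Z_5)); rewrite !intr_morphE /= => /eqP e5.
apply/negP; move: e5; apply/implyP; move: (z%:~R) (v%:~R) (w%:~R).
by case: pZ => ->; apply: Zall3P; vm_compute.
Qed.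

Let c0 : c != 0. Proof. by case: c_def => ->. Qed.
Let p0 : p%:Z != 0. Proof. by have := prime_gt0 p_pr; lia. Qed.

(** Such a prime, if it divides [quad u v], divides none of [c], [p], [u], [v], so its exponent
    there equals its exponent in [k^2]. *)
Lemma quad_logn (q : nat) : prime q -> q \notin [:: 2;
  p]%N -> ~~ odd (logn q `|quad u v|).
Proof.
move=> q_pr; rewrite !inE negb_or => /andP[q2 qp].
have [qQ|/logn_ndvdz-> //] := boolP (q %| quad u v)%Z.
have q3 : q != 3%N by apply: contraTneq qQ => ->; exact: quad_ndvd3.
have q5 : q != 5%N by apply: contraTneq qQ => ->; exact: quad_ndvd5.
have nqn (a : nat) := prime_ndvd_prime q a q_pr.
have nqu : ~~ (q %| u)%Z.
  apply/negP => qu; have : (q %| (2 * 2 * 2 * 2) * v ^+ 2)%Z.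
    have -> : 2 * 2 * 2 * 2 * v ^+ 2 = quad u v - u * (u - 7 * v) :> int by rewrite
    /quad; ring.
    by rewrite rpredB // dvdz_mulr.
  rewrite !prime_dvdzM // (negPf (nqn 2%N isT q2)) /= orbb.
  exact: coprimez_prime q_pr qu.
have nqv : ~~ (q %| v)%Z.
  apply/negP => qv; have : (q %| u ^+ 2)%Z.
    have -> : u ^+ 2 = quad u v + v * (7 * u - 16 * v) :> int by rewrite /quad; ring.
    by rewrite rpredD // dvdz_mulr.
  by rewrite prime_dvdzX // => qu; apply: coprimez_prime uv q_pr qu qv.
have nqc : ~~ (q %| c)%Z.
  case: c_def => ->; first by rewrite dvdzE dvdn1; apply/negP; have := prime_gt1 q_pr;
    lia.
  by rewrite (_ : -15 = -(3 * 5)) // rpredN prime_dvdzM // negb_or !nqn.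
have := odd_logn_sqr q k; rewrite -ek.
rewrite !logn_abszM ?mulf_neq0 // ?gt_eqF ?quad_gt0 //.
by rewrite !(logn_ndvdz _ _ nqu, logn_ndvdz _ _ nqv, logn_ndvdz _ _ nqc, logn_ndvdz _ _
  (nqn _ p_pr qp)) => ->.
Qed.

(** Together with [ek] this would make [2 c u v] a square, so [v] is odd and [u] is even. Powers of
    2 are then removed from [u] step by step, each stage ending in a contradiction modulo 8 or in a
    further factor 4. *)
Lemma quad_2p (m : int) : 2 * p%:Z * quad u v <> m ^+ 2.
Proof.
move=> em.
have even2 (x y : int) : 2 * x = y ^+ 2 -> exists2 z, y = 2 * z & x = 2 * z ^+ 2.
  move=> e; have : (2 %| y)%Z by rewrite -(@prime_dvdzX 2) // -e dvdz_mulr.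
  move=> /dvdzP[z ez]; exists z; first by rewrite mulrC.
  by apply: (@mulfI _ 2) => //; rewrite e ez; ring.
have cE : c%:~R = 1 :> 'Z_8 by apply: (Z_intr_mod 8 c 1) => //; case: c_def => ->.
have pE : p%:Z%:~R = 7 :> 'Z_8 by apply: (Z_intr_mod 8 p%:Z 7); lia.
have [||w ew] := @square_quotient (2 * (c * (u * v))) (p%:Z * quad u v) (k * m).
- by rewrite mulf_neq0 // gt_eqF ?quad_gt0.
- by rewrite [RHS]exprMn -ek -em; ring.
have [w1 _ ew1] := even2 _ _ ew.
have [|m1 _ em1] := even2 (p%:Z * quad u v) m; first by rewrite -em; ring.
have v_odd : ~~ (2 %| v)%Z.
  apply/negP => dv; have : (2 %| p%:Z * quad u v)%Z by rewrite em1 dvdz_mulr.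
  rewrite (@prime_dvdzM 2) // => /orP[|dQ]; first by lia.
  apply: (coprimez_prime 2 u v uv) => //; rewrite -(@prime_dvdzX 2) //.
  have -> : u ^+ 2 = quad u v + v * (7 * u - 16 * v) :> int by rewrite /quad; ring.
  by rewrite rpredD // dvdz_mulr.
have c_odd : ~~ (2 %| c)%Z by case: c_def => ->.
have half (x y : int) : c * (x * v) = 2 * y ^+ 2 ->
    exists2 x', x = 2 * x' & c * (x' * v) = y ^+ 2.
  move=> e; have : (2 %| c * (x * v))%Z by rewrite e dvdz_mulr.
  rewrite !(@prime_dvdzM 2) // (negPf c_odd) (negPf v_odd) orbF => /dvdzP[x' ex].
  exists x'; first by rewrite mulrC.
  by apply: (@mulfI _ 2) => //; rewrite -e ex; ring.
have quarter (x y : int) : c * (x * v) = y ^+ 2 -> (2 %| x)%Z ->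
    exists x' y', x = 4 * x' /\ c * (x' * v) = y' ^+ 2.
  move=> e /dvdzP[x1 ex].
  have [|y' _ e'] := even2 (c * (x1 * v)) y; first by rewrite -e ex; ring.
  have [x' ex' e''] := half _ _ e'; exists x', y'; split=> //.
  by rewrite ex ex'; ring.
have [u1 eu1 ew2] := half _ _ ew1.
have em2 : p%:Z * (2 * u1 ^+ 2 - 7 * (u1 * v) + 8 * v ^+ 2) = m1 ^+ 2.
  by apply: (@mulfI _ 2) => //; rewrite -em1 /quad eu1; ring.
(* The two forms arise for [u = 2 x] and [u = 8 x]. As [c = 1] modulo 8, [x v] is an odd square, so
   [x v = 1] and both forms take the value [7 * 3 = 5] modulo 8. *)
have Zodd (x y z : int) : ~~ (2 %| x)%Z -> c * (x * v) = y ^+ 2 ->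
    p%:Z * (2 * x ^+ 2 - 7 * (x * v) + 8 * v ^+ 2) = z ^+ 2 \/
    p%:Z * (8 * x ^+ 2 - 7 * (x * v) + 2 * v ^+ 2) = z ^+ 2 -> False.
  move=> /Z8_odd x_odd /(congr1 (fun x : int => x%:~R : 'Z_8)).
  rewrite !intr_morphE /= cE => /eqP exy.
  have /eqP xv : x%:~R * v%:~R == 1 :> 'Z_8.
    move: exy x_odd (Z8_odd v v_odd); move=> exy xo; apply/implyP.
    move: xo; apply/implyP; move: exy; apply/implyP.
    by move: (x%:~R) (v%:~R) (y%:~R); apply: Zall3P; vm_compute.
  case=> /(congr1 (fun x : int => x%:~R : 'Z_8)); rewrite !intr_morphE /= pE xv => /eqP;
    apply/negP; move: x_odd; apply/implyP;
    move: (x%:~R) (v%:~R) (z%:~R); apply: Zall3P; by vm_compute.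
have [u1_even|/Zodd h] := boolP (2 %| u1)%Z; last by apply: h ew2 (or_introl em2).
have [u2 [w2 [eu2 ew3]]] := quarter _ _ ew2 u1_even.
have [|m2 _ em3] := even2 (2 * (p%:Z * (8 * u2 ^+ 2 - 7 * (u2 * v) + 2 * v ^+ 2))) m1.
  by rewrite -em2 eu2; ring.
have {}em3 : p%:Z * (8 * u2 ^+ 2 - 7 * (u2 * v) + 2 * v ^+ 2) = m2 ^+ 2.
  by apply: (@mulfI _ 2).
have [u2_even|/Zodd h] := boolP (2 %| u2)%Z; last by apply: h ew3 (or_intror em3).
have [u3 [w3 [eu3 _]]] := quarter _ _ ew3 u2_even.
move: em3 (Z8_odd v v_odd); rewrite eu3 => /(congr1 (fun x : int => x%:~R : 'Z_8)).
rewrite !intr_morphE /= pE => /eqP e8; apply/negP; move: e8; apply/implyP.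
by move: (u3%:~R) (v%:~R) (m2%:~R); apply: Zall3P; vm_compute.
Qed.

(** The possible classes are 1, 2, [p] and [2 p]. Modulo 3 the form is the nonzero square
    [(u + v)^2], whereas 2 and [p] are non-squares, and [quad_2p] removes the last class. *)
Lemma quad_square : exists N, quad u v = N ^+ 2.
Proof.
have Q0 := quad_gt0; have Qn : (0 < `|quad u v|)%N by lia.
have p2 : 2%N \notin [:: p] by rewrite inE; apply/eqP => e; move: p8; rewrite -e.
have [||m] := square_class [:: 2; p]%N _ Qn _ _ quad_logn.
- by rewrite /= p_pr.
- by rewrite /= p2.
rewrite !big_cons big_nil muln1 => em.
have {}em : 2 ^+ odd (logn 2 `|quad u v|) * p%:Z ^+ odd (logn p `|quad u v|) * quad u v
  = m%:Z ^+ 2.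
  move/(congr1 (fun n : nat => n%:R : int)): em.
  by rewrite !natrM !natrX !natz gtz0_abs.
case: (odd _) em; case: (odd _) => /= em.
- by case: (quad_2p m%:Z); rewrite -em.
- case/negP: quad_ndvd3; rewrite -(@Z_intr_eq0 3) //.
  move/(congr1 (fun x : int => x%:~R : 'Z_3)): em; rewrite /quad !intr_morphE /= => /eqP.
  by apply/implyP; move: (u%:~R) (v%:~R) (m%:~R); apply: Zall3P; vm_compute.
- case/negP: quad_ndvd3; rewrite -(@Z_intr_eq0 3) //.
  have pE : p%:Z%:~R = 2 :> 'Z_3 by apply: (Z_intr_mod 3 p%:Z 2); lia.
  move/(congr1 (fun x : int => x%:~R : 'Z_3)): em;
    rewrite /quad !intr_morphE /= pE => /eqP.
  by apply/implyP; move: (u%:~R) (v%:~R) (m%:~R); apply: Zall3P; vm_compute.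
- by exists m%:Z; rewrite -em; ring.
Qed.
End FirstDescent.

(** * Descent on the 2-isogenous curve: the class of [u v] *)

Section SecondDescent.
Variables (c u v k : int).
Hypotheses (c_def : c = 1 \/ c = -15) (uv : coprimez u v) (k0 : k != 0).
Let W := (u - v) * (u + 15 * v).
Hypothesis ek : c * p%:Z * (u * v) * W = k ^+ 2.

Let c0 : c != 0. Proof. by case: c_def => ->. Qed.
Let p0 : p%:Z != 0. Proof. by have := prime_gt0 p_pr; lia. Qed.
Let k20 : k ^+ 2 != 0. Proof. exact: expf_neq0. Qed.
Let n0 : u * v != 0. Proof. by apply: contraNneq k20 => e; rewrite -ek e mulr0 mul0r. Qed.
Let W0 : W != 0. Proof. by apply: contraNneq k20 => e; rewrite -ek e mulr0. Qed.

(** [W] is [-15 v^2] modulo [u] and [u^2] modulo [v], so with [u] and [v] coprime only 3 and 5 can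
    be common prime factors. *)
Lemma ndvd_W (q : nat) : prime q -> q != 3%N -> q != 5%N ->
  (q %| u * v)%Z -> ~~ (q %| W)%Z.
Proof.
move=> q_pr q3 q5 qn; apply/negP => qW.
have nq15 : ~~ (q %| 3%:Z * 5%:Z)%Z.
  by rewrite prime_dvdzM // negb_or !(prime_ndvd_prime q).
move: qn; rewrite prime_dvdzM // => /orP[qu|qv].
  have : (q %| 3%:Z * 5%:Z * v ^+ 2)%Z.
    have -> : 3%:Z * 5%:Z * v ^+ 2 = u * (u + 14 * v) - W by rewrite /W; ring.
    by rewrite rpredB // dvdz_mulr.
  rewrite prime_dvdzM // (negPf nq15) prime_dvdzX //=.
  exact: coprimez_prime uv q_pr qu.
have : (q %| u ^+ 2)%Z.
  have -> : u ^+ 2 = W + v * (15 * v - 14 * u) by rewrite /W; ring.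
  by rewrite rpredD // dvdz_mulr.
by rewrite prime_dvdzX // => qu; apply: coprimez_prime uv q_pr qu qv.
Qed.

Lemma ndvd_c (q : nat) : prime q -> q != 3%N -> q != 5%N -> ~~ (q %| c)%Z.
Proof.
move=> q_pr q3 q5; case: c_def => ->.
  by rewrite dvdzE dvdn1; apply/negP; have := prime_gt1 q_pr; lia.
by rewrite (_ : -15 = -(3 * 5)) // rpredN prime_dvdzM // negb_or !prime_ndvd_prime.
Qed.

Lemma prod_logn (q : nat) : prime q -> q \notin [:: 3; 5; p]%N ->
  ~~ odd (logn q `|u * v|).
Proof.
move=> q_pr; rewrite !inE !negb_or => /and3P[q3 q5 qp].
have [qn|/logn_ndvdz-> //] := boolP (q %| u * v)%Z.
have := odd_logn_sqr q k; rewrite -ek.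
have cp0 := mulf_neq0 c0 p0.
rewrite (logn_abszM q _ _ (mulf_neq0 cp0 n0) W0) (logn_abszM q _ _ cp0 n0) (logn_abszM
  q _ _ c0 p0).
rewrite (logn_ndvdz _ _ (ndvd_W _ q_pr q3 q5 qn)) (logn_ndvdz _ _ (ndvd_c _ q_pr q3 q5)).
by rewrite (logn_ndvdz _ _ (prime_ndvd_prime _ _ q_pr p_pr qp)) !add0n addn0 => ->.
Qed.

Let p_odd : odd p. Proof. by lia. Qed.
Let pn3 : p != 3%N. Proof. by apply/eqP => e; move: p8; rewrite e. Qed.
Let pn5 : p != 5%N. Proof. by apply/eqP => e; move: p8; rewrite e. Qed.

Lemma chi_c : chi p c = 1.
Proof.
case: c_def => ->; first by rewrite /chi expr1n.
by rewrite (_ : -15 = -3 * 5) // chiM chiN3 // chi5 // mulrNN mulr1.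
Qed.

(** Modulo [p] the form [W] is [-15 v^2] or [u^2], and -15 is a square modulo [p]. *)
Lemma chi_W : (p %| u * v)%Z -> chi p W = 1.
Proof.
move=> pn; have := ndvd_W _ p_pr pn3 pn5 pn.
move: pn; rewrite prime_dvdzM // => /orP[pu|pv] pW.
  have pv : ~~ (p %| v)%Z by apply/negP; apply: coprimez_prime uv p_pr pu.
  rewrite (@chi_eqmod p _ (-3 * 5 * v ^+ 2)) //.
    by rewrite chiM chi_sqr // chiM chiN3 // chi5 // mulrNN !mulr1.
  have -> : W - -3 * 5 * v ^+ 2 = u * (u + 14 * v) by rewrite /W; ring.
  by rewrite dvdz_mulr.
have pu : ~~ (p %| u)%Z by apply/negP => pu; apply: coprimez_prime uv p_pr pu pv.
rewrite (@chi_eqmod p _ (u ^+ 2)) ?chi_sqr //.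
have -> : W - u ^+ 2 = v * (14 * u - 15 * v) by rewrite /W; ring.
by rewrite dvdz_mulr.
Qed.

(* Here u v is congruent to v^2 or to -15 v^2 modulo p. *)
Lemma chi_prod : ~~ (p %| u * v)%Z -> (p %| W)%Z -> chi p (u * v) = 1.
Proof.
rewrite prime_dvdzM // negb_or => /andP[pu pv]; rewrite prime_dvdzM // => /orP[pW|pW].
  rewrite (@chi_eqmod p _ (v ^+ 2)) ?chi_sqr // (_ : _ - _ = (u - v) * v); last by ring.
  by rewrite dvdz_mulr.
rewrite (@chi_eqmod p _ (-3 * 5 * v ^+ 2)) //.
  by rewrite chiM chi_sqr // chiM chiN3 // chi5 // mulrNN !mulr1.
rewrite (_ : _ - _ = (u + 15 * v) * v); last by ring.
by rewrite dvdz_mulr.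
Qed.

(* The part prime to p of the class of u v is a square modulo p. *)
Lemma chi_class (e m : int) (l : bool) : ~~ (p %| e)%Z ->
  e * p%:Z ^+ l * (u * v) = m ^+ 2 -> chi p e = 1.
Proof.
move=> pe em; have [w ew] : exists w, c * p%:Z * (e * p%:Z ^+ l) * W = w ^+ 2.
  apply: (@square_quotient _ (u * v) (k * m)) => //.
  by rewrite [RHS]exprMn -ek -em; ring.
have pc := ndvd_c _ p_pr pn3 pn5.
(* If [l] holds, [p] divides [u v] and not [W], and the character is read off from the square
   [c e W]. Otherwise [p] divides [W] and not [u v], and it is read off from [e u v]. *)
case: l em ew => /= em ew.
  have pn : (p %| u * v)%Z.
    have : (p %| m)%Z by rewrite -prime_dvdzX // -em mulrAC dvdz_mull ?dvdzz.
    case/dvdzP => m1 em1; have : (p %| e * (u * v))%Z.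
      apply/dvdzP; exists (m1 ^+ 2); apply: (@mulIf _ p%:Z) => //.
      by transitivity (m ^+ 2); [rewrite -em; ring|rewrite em1; ring].
    by rewrite prime_dvdzM // (negPf pe).
  have pW := ndvd_W _ p_pr pn3 pn5 pn.
  have [||w1 ew1] := @square_quotient (c * e * W) p%:Z w; first by [].
    by rewrite -ew; ring.
  have pw1 : ~~ (p %| w1)%Z.
    by rewrite -prime_dvdzX // -ew1 (prime_dvdzM p _ W) // (prime_dvdzM p c e) //
    !negb_or pc pe.
  by have := chi_sqr p w1 p_pr p_odd pw1; rewrite -ew1 (chiM p _ W) (chiM p c e) chi_c
    chi_W // mul1r mulr1.
rewrite mulr1 in em ew.
have pW : (p %| W)%Z.
  have : (p %| w)%Z by rewrite -prime_dvdzX // -ew -!mulrA mulrCA dvdz_mulr ?dvdzz.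
  case/dvdzP => w1 ew1; have : (p %| c * (e * W))%Z.
    apply/dvdzP; exists (w1 ^+ 2); apply: (@mulIf _ p%:Z) => //.
    by transitivity (w ^+ 2); [rewrite -ew; ring|rewrite ew1; ring].
  by rewrite (prime_dvdzM p c) // (prime_dvdzM p e) // (negPf pc) (negPf pe).
have pn : ~~ (p %| u * v)%Z.
  apply/negP => pn; have := ndvd_W _ p_pr pn3 pn5 pn.
  by rewrite pW.
have pm : ~~ (p %| m)%Z by rewrite -prime_dvdzX // -em prime_dvdzM // negb_or pe.
by have := chi_sqr p m p_pr p_odd pm; rewrite -em chiM chi_prod // mulr1.
Qed.

(** Signs and the primes 3, 5, [p] allow sixteen classes. The character modulo [p] leaves 1, 3, -5,
    -15, each possibly times [p]; those from 3 and -5 are 3 or 5 modulo 8, which [dyadic]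
    forbids. *)
Lemma prod_class : exists e m : int, [/\ e \in [:: 1; -15; p%:Z; -15 * p%:Z],
  m != 0 & e * (u * v) = m ^+ 2].
Proof.
have [|||m] := square_class [:: 3; 5; p]%N `|u * v| _ _ _ prod_logn.
- by rewrite absz_gt0.
- by rewrite /= p_pr.
- by rewrite /= !inE negb_or ![_ == p]eq_sym pn3 pn5.
rewrite !big_cons big_nil muln1 => em.
have {}em : sgz (u * v) * 3 ^+ odd (logn 3 `|u * v|) * 5 ^+ odd (logn 5 `|u * v|) *
  p%:Z ^+ odd (logn p `|u * v|) * (u * v) = m%:Z ^+ 2.
  move/(congr1 (fun n : nat => n%:R : int)): em.
  rewrite !natrM !natrX !natz => {}em; rewrite [RHS]expr2 -em abszEsg; ring.
have s1 : sgz (u * v) = 1 \/ sgz (u * v) = -1 by move: n0; case: sgzP; [|left|right].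
have m0 : m%:Z != 0.
  rewrite -sqrf_eq0 -em; apply: mulf_neq0 n0; rewrite !mulf_neq0 ?expf_neq0 //.
  by case: s1 => ->.
have c8 : (c * p%:Z %% 8 = 7)%Z by case: c_def => ->; clear -p8; lia.
have chi3 : chi p 3 = 1.
  by rewrite (_ : 3 = -1 * -3) // chiM chiN1 // chiN3 // mulrNN mulr1.
have no_sqrN1 : (-1 : 'F_p) <> 1.
  move=> e; have /eqP := p_nat_neq0 2 isT; apply.
  by have -> : 2%:R = 1 - (-1) :> 'F_p by [ring]; rewrite e subrr.
have : exists2 e1 : int, e1 \in [:: 1; -1; 3; -3; 5; -5; 15; -15] & exists l : bool,
    e1 * p%:Z ^+ l * (u * v) = m%:Z ^+ 2.
  exists (sgz (u * v) * 3 ^+ odd (logn 3 `|u * v|) * 5 ^+ odd (logn 5 `|u * v|)).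
    by case: s1 => ->; case: (odd _); case: (odd _).
  by exists (odd (logn p `|u * v|)).
case=> e1 e1_in [l {}em].
have pe1 : ~~ (p %| e1)%Z.
  have := p_ndvd; rewrite !dvdzE => h.
  by move: e1_in; rewrite !inE =>
    /or4P[/eqP->|/eqP->|/eqP->|/or4P[/eqP->|/eqP->|/eqP->|/orP[]/eqP->]];
    first [exact: (h 1%N isT)|exact: (h 3%N isT)|exact: (h 5%N isT)|exact: (h 15%N isT)].
have chi_e := chi_class _ _ _ pe1 em.
have [w ew] : exists w, c * p%:Z * (e1 * p%:Z ^+ l) * W = w ^+ 2.
  apply: (@square_quotient _ (u * v) (k * m)) => //.
  by rewrite [RHS]exprMn -ek -em; ring.
have no_dyadic h := dyadic _ _ _ _ _ _ uv c8 h em ew.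
exists (e1 * p%:Z ^+ l); exists m%:Z; split=> //.
move: e1_in chi_e no_dyadic; rewrite !inE.
move=> /or4P[/eqP->|/eqP->|/eqP->|/or4P[/eqP->|/eqP->|/eqP->|/orP[]/eqP->]].
- by case: (l); rewrite ?mul1r ?eqxx ?orbT.
- by rewrite chiN1 // => /no_sqrN1.
- by move=> _ []; case: (l); rewrite ?expr1 ?expr0; clear -p8; lia.
- by rewrite chiN3 // => /no_sqrN1.
- by rewrite chi5 // => /no_sqrN1.
- by move=> _ []; case: (l); rewrite ?expr1 ?expr0; clear -p8; lia.
- by rewrite (_ : 15 = 3 * 5) // chiM chi3 chi5 // mul1r => /no_sqrN1.
- by case: (l); rewrite ?expr1 ?mulr1 ?eqxx ?orbT.
Qed.
End SecondDescent.

(** * The descents for rational coordinates *)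

Section Rational.
Variables (c : int) (D : rat).
Hypotheses (c_def : c = 1 \/ c = -15) (D_def : D = (c * p%:Z)%:~R).

Let D0 : D != 0.
Proof.
rewrite D_def intr_eq0; apply: mulf_neq0; first by case: c_def => ->.
by have := prime_gt0 p_pr; lia.
Qed.

Let cpD : c%:~R * p%:Z%:~R = D. Proof. by rewrite D_def rmorphM. Qed.

Lemma ratio_coprime (x : rat) : x != 0 -> exists u v : int,
  [/\ coprimez u v, u != 0, v != 0 & x = D * (u%:~R / v%:~R)].
Proof.
move=> x0; exists (numq (x / D)), (denq (x / D)).
rewrite divq_num_den mulrCA divff // mulr1; split=> //; first exact: coprime_num_den.
by rewrite numq_eq0 mulf_neq0 ?invr_eq0.
Qed.

Lemma first_descent (x y : rat) : x != 0 ->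
  y ^+ 2 = x ^+ 3 - 7 * D * x ^+ 2 + 16 * D ^+ 2 * x -> exists s, x = s ^+ 2.
Proof.
move=> x0; have [u [v [uv u0 v0 ->]]] := ratio_coprime x x0 => e.
have vr0 : v%:~R != 0 :> rat by rewrite intr_eq0.
have [|k ek _] := intr_square (c * p%:Z * (u * v) * quad u v) (y * v%:~R ^+ 2 / D).
  rewrite !expr_div_n exprMn e /quad !intr_morphE /= cpD.
  by field; rewrite vr0 D0.
have [N eN] := quad_square c u v k c_def uv u0 v0 ek.
have N0 : N != 0.
  have := quad_gt0 c u v k c_def uv u0 v0 ek.
  by rewrite eN => /gt_eqF; rewrite sqrf_eq0 => ->.
have Nr0 : N%:~R != 0 :> rat by rewrite intr_eq0.
(* Indeed [D u / v = c p u v / v^2 = k^2 / (quad u v * v^2)]. *)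
exists (k%:~R / (N * v)%:~R).
rewrite expr_div_n -[k%:~R ^+ 2]rmorphXn /= -ek eN !intr_morphE /= cpD.
by field; rewrite vr0 Nr0.
Qed.

(** As [D = c p], multiplication by [D] permutes the classes 1, -15, [p], [-15 p] modulo squares, so
    the result can be stated through [D] for both values of [c] at once. *)
Lemma second_descent (x y : rat) : y != 0 -> y ^+ 2 = x * (x - D) * (x + 15 * D) ->
  (exists t, [\/ x = t ^+ 2, x = -15 * t ^+ 2, D * x = t ^+ 2 | D * x = -15 * t ^+ 2]).
Proof.
move=> y0 e; have x0 : x != 0.
  by apply: contraNneq y0 => x0; rewrite -sqrf_eq0 e x0 !mul0r.
move: e; have [u [v [uv u0 v0 ex]]] := ratio_coprime x x0; rewrite ex => e.
have vr0 : v%:~R != 0 :> rat by rewrite intr_eq0.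
have [|k ek ek'] := intr_square (c * p%:Z * (u * v) * ((u - v) * (u + 15 * v))) (y *
  v%:~R ^+ 2 / D).
  rewrite !expr_div_n exprMn e !intr_morphE /= cpD.
  by field; rewrite vr0 D0.
have k0 : k != 0.
  by rewrite -(intr_eq0 rat) -ek' !mulf_neq0 ?invr_eq0 ?expf_neq0.
have [f [m [f_in m0 em]]] := prod_class c u v k c_def uv k0 ek.
have f0 : f != 0.
  have : p%:Z != 0 by have := prime_gt0 p_pr; lia.
  by move: f_in; rewrite !inE => /or4P[]/eqP-> // ?; rewrite mulf_neq0.
have fr0 : f%:~R != 0 :> rat by rewrite intr_eq0.
pose t := m%:~R / (f%:~R * v%:~R) : rat.
have {}ex : D * (u%:~R / v%:~R) = D * f%:~R * t ^+ 2.
  rewrite /t expr_div_n -[m%:~R ^+ 2]rmorphXn /= -em !intr_morphE /=.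
  by field; rewrite vr0 fr0.
rewrite ex; move: f_in; rewrite !inE => /or4P[]/eqP->.
- by exists (D * t); constructor 3; ring.
- by exists (D * t); constructor 4; rewrite intr_morphE; ring.
- exists (p%:Z%:~R * t); rewrite D_def; case: c_def => ->; rewrite !intr_morphE /=.
    by constructor 1; ring.
  by constructor 2; ring.
(* For [c = -15] the product of [D] and [-15 p] is [(15 p)^2], hence the extra factor 15. *)
exists (p%:Z%:~R * t * (if c == 1 then 1 else 15)); rewrite D_def;
  case: c_def => -> /=; rewrite !intr_morphE /=.
  by constructor 2; ring.
by constructor 1; ring.
Qed.

(* If (s^2, s w) is the image of (x', 2 s x') under the 2-isogeny from
   y^2 = x (x - D) (x + 15 D), then so are the points obtained from (s^2, s w)
   by changing its sign and by adding (0, 0); one of their preimages has a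
   square abscissa. *)
Lemma isogeny_square (s w : rat) : s != 0 ->
  w ^+ 2 = s ^+ 4 - 7 * D * s ^+ 2 + 16 * D ^+ 2 ->
  exists t, [\/ t ^+ 2 = 2 * s ^+ 2 - 7 * D + 2 * w,
    t ^+ 2 = 2 * s ^+ 2 - 7 * D + 2 * - w,
    t ^+ 2 = 2 * (4 * D / s) ^+ 2 - 7 * D + 2 * (4 * D * w / s ^+ 2) |
    t ^+ 2 = 2 * (4 * D / s) ^+ 2 - 7 * D + 2 * - (4 * D * w / s ^+ 2)].
Proof.
move=> s0 ew; pose X := 2 * s ^+ 2 - 7 * D + 2 * w;
  pose Y := 2 * s ^+ 2 - 7 * D + 2 * - w.
have XY : X * Y = -15 * D ^+ 2.
  transitivity ((2 * s ^+ 2 - 7 * D) ^+ 2 - 4 * w ^+ 2); first by rewrite /X /Y; ring.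
  by rewrite ew; ring.
have /andP[X0 Y0] : (X != 0) && (Y != 0).
  by rewrite -negb_or -mulf_eq0 XY; apply: mulf_neq0 (expf_neq0 2 D0).
have eX : (X - D) * (X + 15 * D) = 4 * s ^+ 2 * X.
  transitivity (X * (X + 14 * D) + -15 * D ^+ 2); first by ring.
  by rewrite -XY /X /Y; ring.
have X1 : X - D != 0.
  apply: contraNneq (mulf_neq0 (mulf_neq0 (isT : 4 != 0 :> rat) (expf_neq0 2 s0)) X0).
  by rewrite -eX => ->; rewrite mul0r.
pose U := 2 * (4 * D / s) ^+ 2 - 7 * D + 2 * (4 * D * w / s ^+ 2).
pose V := 2 * (4 * D / s) ^+ 2 - 7 * D + 2 * - (4 * D * w / s ^+ 2).
have eU : U * (X - D) = D * (X + 15 * D).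
  apply: (mulIf (expf_neq0 2 s0)); apply/eqP; rewrite -subr_eq0; apply/eqP.
  transitivity (16 * D * (w ^+ 2 - (s ^+ 4 - 7 * D * s ^+ 2 + 16 * D ^+ 2))).
    by rewrite /U /X; field.
  by rewrite ew subrr mulr0.
have eU2 : U = D * X * (2 * s / (X - D)) ^+ 2.
  apply: (mulIf (expf_neq0 2 X1)); rewrite expr2 mulrA eU.
  by transitivity (D * ((X - D) * (X + 15 * D))); [ring|rewrite eX; field].
have UV : U * V = -15 * D ^+ 2.
  transitivity ((2 * (4 * D / s) ^+ 2 - 7 * D) ^+ 2 - 4 * (16 * D ^+ 2 / s ^+ 4) * w ^+
    2).
    by rewrite /U /V; field.
  by rewrite ew; field.
have other (a b t : rat) : a * b = -15 * D ^+ 2 -> a = -15 * t ^+ 2 ->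
  exists t', t' ^+ 2 = b.
  move=> ab ea; have t0 : t != 0.
    apply: contraNneq (expf_neq0 2 D0) => t0; apply/eqP/(@mulfI _ (-15)) => //.
    by rewrite -ab ea t0; ring.
  exists (D / t); apply: (@mulfI _ (-15 * t ^+ 2));
    first exact: mulf_neq0 (expf_neq0 2 t0).
  by rewrite -ea ab ea; field.
(* According as the class of [X] is 1, -15, [D] or [-15 D], the square is [X], [Y], [U] or [V]: both
   [X Y] and [U V] equal [-15 D^2], and [U] is [D X] up to a square. *)
have [||t [et|et|et|et]] := second_descent X (2 * s * X).
- by rewrite !mulf_neq0.
- by rewrite -[RHS]mulrA eX; ring.
- by exists t; constructor 1.
- by have [t' et'] := other _ _ _ XY et; exists t'; constructor 2.
- by exists (t * (2 * s / (X - D))); constructor 3; rewrite exprMn -et -/U eU2.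
have [|t' et'] := other _ _ (t * (2 * s / (X - D))) UV.
  by rewrite eU2 et; ring.
by exists t'; constructor 4.
Qed.
End Rational.

(** * Every point of the twist is torsion *)

Section Twist.
Variables (c : int) (D : rat) (D0 : D != 0).
Hypotheses (c_def : c = 1 \/ c = -15) (D_def : D = (c * p%:Z)%:~R).
Let d := c * p%:Z.
Let E := twist X1_15 D D0.

Let aE : coef_a E = -7 * D. Proof. by []. Qed.
Let bE : coef_b E = 16 * D ^+ 2. Proof. by []. Qed.

Let d0 : d != 0. Proof. by rewrite -(intr_eq0 rat) -D_def. Qed.

Lemma twist_square_abscissa (P : point E) (x y : rat) : point_val P = Some (x, y) ->
  x != 0 -> exists s w, [/\ s != 0, point_val P = Some (s ^+ 2, s * w) &
    w ^+ 2 = s ^+ 4 - 7 * D * s ^+ 2 + 16 * D ^+ 2].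
Proof.
move=> eP x0; have := point_on P; rewrite eP => on.
have e2 : y ^+ 2 = x ^+ 3 + coef_a E * x ^+ 2 + coef_b E * x := eqP on.
have [|s es] := first_descent c D c_def D_def x y x0.
  by rewrite e2 aE bE; ring.
have s0 : s != 0 by rewrite -sqrf_eq0 -es.
exists s, (y / s); split=> //; first by rewrite -es mulrC divfK.
by rewrite expr_div_n e2 aE bE es; field.
Qed.

Lemma bounded_halving (L : int) (s w t : rat) (P : point E) :
  point_val P = Some (s ^+ 2, s * w) ->
  w ^+ 2 = s ^+ 4 - 7 * D * s ^+ 2 + 16 * D ^+ 2 ->
  t ^+ 2 = 2 * s ^+ 2 - 7 * D + 2 * w ->
  height_le L s ->
  exists (R : point E) z y, [/\ R + R = P, point_val R = Some (z ^+ 2, y), z != 0 &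
    numq z ^+ 4 <= 64 * 16 * 19 * `|d| ^+ 3 * L /\
    denq z ^+ 4 <= 64 * 16 * 19 * `|d| ^+ 3 * L].
Proof.
move=> eP ew et hL.
have ew' : w ^+ 2 = s ^+ 4 + coef_a E * s ^+ 2 + coef_b E by rewrite ew aE bE; ring.
have et' : t ^+ 2 = 2 * s ^+ 2 + coef_a E + 2 * w by rewrite et aE; ring.
(* [t^2] times its conjugate under [w -> - w] is [-15 D^2]. *)
have t0 : t != 0.
  apply: contraNneq (mulf_neq0 (isT : -15 != 0 :> rat) (expf_neq0 2 D0)) => t0.
  have -> : -15 * D ^+ 2 = t ^+ 2 * (2 * s ^+ 2 - 7 * D - 2 * w).
    transitivity ((2 * s ^+ 2 - 7 * D) ^+ 2 - 4 * w ^+ 2); first by rewrite ew; ring.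
    by rewrite et; ring.
  by rewrite t0 expr0n mul0r.
have [R eR RR] := halving rat E s w t P eP ew' et' t0.
have er := halving_quotient rat E s w t ew' et'.
set r := s ^+ 2 + s * t + w in er eR.
have r0 : r != 0.
  by apply: contraNneq (coef_b_neq0 rat E) => r0; rewrite -er r0 mul0r.
have [z [y [z0 eR' _]]] := twist_square_abscissa R _ _ eR r0.
exists R, z, (z * y); split=> //.
have zr : r = z ^+ 2 by move: eR'; rewrite eR => -[].
have eD : 16 * D ^+ 2 = 16 * d%:~R ^+ 2 by rewrite D_def.
apply: (height_half L d s w t z) => //; rewrite -?D_def //.
by rewrite -bE -er aE -zr; clearbody r; field.
Qed.

(** The constant of [height_half] times the loss [16 d^2] caused by a translation by [(0, 0)]. *)
Let K := 64 * 16 * 19 * `|d| ^+ 3 * (16 * d ^+ 2).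

Definition bounded (L : int) (P : point E) :=
  exists s y, [/\ point_val P = Some (s ^+ 2, y), s != 0 & height_le L s].

(** By [isogeny_square] one of the points [P], [- P], [P + (0, 0)], [- (P + (0, 0))] can be halved.
    Doubling kills [(0, 0)], and the sign is absorbed in [R]. *)
Lemma bounded_step (L : int) (P : point E) : K <= L -> bounded L P ->
  exists2 R, bounded L R & P *+ 2 = R *+ 4.
Proof.
move=> KL [s1 [y1 [eP1 s10 hL1]]].
have [|s [w [s0 eP ew]]] := twist_square_abscissa P _ _ eP1; first by rewrite expf_neq0.
have es : s1 ^+ 2 = s ^+ 2 by move: eP1; rewrite eP => -[->].
have hL : height_le L s.
  by move/eqP: es hL1; rewrite eqf_sqr => /orP[]/eqP-> //;
    rewrite /height_le numqN sqrrN denqN.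
have L0 : 0 <= L := le_trans (sqr_ge0 _) hL.1.
have d2 : 1 <= 16 * d ^+ 2 by have : 0 < d ^+ 2 by [rewrite lt_def sqrf_eq0 d0
  sqr_ge0]; lia.
have hL' : height_le (16 * d ^+ 2 * L) s.
  by case: hL => hn hd; split; rewrite (le_trans _ (ler_peMl L0 d2)).
(* The bound on the fourth power is [K L], at most [L^2], so the half obeys the same bound [L] as
   the point. *)
have LL (n : int) : n ^+ 4 <= 64 * 16 * 19 * `|d| ^+ 3 * (16 * d ^+ 2 * L) -> n ^+ 2 <= L.
  move=> h; rewrite -(@ler_pXn2r _ 2) ?nnegrE ?sqr_ge0 // -exprM.
  by rewrite (le_trans h) // mulrA expr2 ler_wpM2r.
have main (s' w' t : rat) (Q : point E) : point_val Q = Some (s' ^+ 2, s' * w') ->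
    w' ^+ 2 = s' ^+ 4 - 7 * D * s' ^+ 2 + 16 * D ^+ 2 ->
    t ^+ 2 = 2 * s' ^+ 2 - 7 * D + 2 * w' -> height_le (16 * d ^+ 2 * L) s' ->
    P *+ 2 = Q *+ 2 \/ P *+ 2 = - (Q *+ 2) -> exists2 R, bounded L R & P *+ 2 = R *+ 4.
  move=> eQ ew' et' h' PQ.
  have [R [z [y [RR eR z0 [/LL hn /LL hd]]]]] := bounded_halving _ _ _ _ _ eQ ew' et' h'.
  have Q2 : Q *+ 2 = R *+ 4 by rewrite -RR -mulr2n -mulrnA.
  case: PQ => ->; rewrite Q2; first by exists R => //; exists z, y; split.
  by exists (- R); [exists z, (- y); rewrite /= eR; split|rewrite mulNrn].
have hD : height_le (16 * d ^+ 2 * L) (4 * D / s) by rewrite D_def;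
  apply: height_quotient.
have ewD (w' : rat) : w' ^+ 2 = w ^+ 2 -> (4 * D * w' / s ^+ 2) ^+ 2 =
    (4 * D / s) ^+ 4 - 7 * D * (4 * D / s) ^+ 2 + 16 * D ^+ 2.
  by move=> e; rewrite expr_div_n exprMn e ew; field.
have x0 : s ^+ 2 != 0 by rewrite expf_neq0.
have eT := translate_point00 rat E _ _ P eP x0.
have PT : (P + point00 rat E) *+ 2 = P *+ 2 by rewrite mulrnDl [_ *+ 2 in X in _ +
  X]mulr2n point00_2 addr0.
have [t [et|et|et|et]] := isogeny_square c D c_def D_def s w s0 ew.
- by apply: main eP ew et hL' _; left.
- apply: (main s (- w) t (- P)) => //; rewrite ?sqrrN //; last by right;
  rewrite mulNrn opprK.
  by rewrite -[LHS]/(eopp (point_val P)) eP /= mulrN.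
- apply: (main _ _ _ (- (P + point00 rat E)) _ (ewD w erefl) et hD).
    rewrite -[LHS]/(eopp (point_val (P + point00 rat E))) eT bE /=.
    by congr (Some (_, _)); field.
  by right; rewrite mulNrn opprK PT.
apply: (main _ _ _ (P + point00 rat E) _ _ et hD).
- by rewrite eT bE; congr (Some (_, _)); field.
- by rewrite sqrrN ewD.
by left; rewrite PT.
Qed.

Lemma twist_torsion (P : point E) : exists2 n, (0 < n)%N & P *+ n = 0.
Proof.
case eP : (point_val P) => [[x y]|]; last first.
  by exists 1%N => //; apply: val_inj; rewrite /= eP.
have [x0|x0] := eqVneq x 0.
  by exists 2%N => //; apply: (point_abscissa0 _ _ _ y); rewrite eP x0.
have [s [w [s0 eP' _]]] := twist_square_abscissa P _ _ eP x0.
have K0 : 0 <= K by apply: mulr_ge0; apply: mulr_ge0 => //; rewrite ?sqr_ge0 ?exprn_ge0.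
(* Large enough both for [bounded_step] and for the starting point. *)
pose L := K + numq s ^+ 2 + denq s ^+ 2.
have KL : K <= L by rewrite /L -addrA lerDl addr_ge0 ?sqr_ge0.
have nL : numq s ^+ 2 <= L by rewrite /L addrAC lerDr addr_ge0 ?sqr_ge0.
have dL : denq s ^+ 2 <= L by rewrite /L lerDr addr_ge0 ?sqr_ge0.
pose T := ('I_(`|L|.+1) * 'I_(`|L|.+1))%type.
(* The code holds the numerator and denominator of a root of the abscissa up to sign, and so
   determines the point up to sign. *)
pose code (Q : point E) (i : T) :=
  exists y, point_val Q = Some (((i.1 : nat)%:R / (i.2 : nat)%:R) ^+ 2, y).
apply: (@orbit_torsion (point E) T (bounded L) code); last first.
- by exists s, (s * w).
- by move=> Q; apply: bounded_step.
- move=> Q R i [y1 e1] [y2 e2]; exact: point_eq_opp e1 e2.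
move=> Q [z [y1 [eQ z0 [hn hd]]]].
exists (Ordinal (absz_sqr_lt _ _ hn), Ordinal (absz_sqr_lt _ _ hd)); exists y1;
  rewrite eQ /=.
congr (Some (_, _)); rewrite -[z in LHS]divq_num_den !expr_div_n -!natrX.
have abs2 (n : int) : n%:~R ^+ 2 = (`|n| ^ 2)%N%:R :> rat.
  by rewrite -rmorphXn /= pmulrn -abszX gez0_abs ?sqr_ge0.
by rewrite !abs2.
Qed.
End Twist.

End Descent.

(** * From torsion to rank zero *)

Lemma torsion_rank0 (G : zmodType) :
  (forall P : G, exists2 n, (0 < n)%N & P *+ n = 0) -> has_rank G 0.
Proof.
move=> tors; split; first by exists (fun=> 0) => c _ [].
case=> // m v free; have [n n0 e] := tors (v ord0).
have := free (fun i => if i == ord0 then n%:Z else 0).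
rewrite (bigD1 ord0) //= big1; last by move=> i /negPf->; rewrite mulr0z.
by rewrite addr0 -pmulrn e => /(_ erefl ord0) /= [n1]; rewrite n1 in n0.
Qed.

Theorem theorem5 (p : nat) (p_prime : prime p)
    (p_mod8 : (p = 7 %[mod 8])%N) (p_mod3 : (p = 2 %[mod 3])%N)
    (p_leg5 : legendre p%:Z 5 = -1) :
  has_rank (point (twist X1_15 p%:R (prime_natr_neq0 p_prime))) 0 /\
  has_rank (point (twist X1_15 (- (15 * p%:R)) (prime_neg15_neq0 p_prime))) 0.
Proof.
have p5 := legendre5 p p_leg5.
split; apply: torsion_rank0.
  by apply: (twist_torsion p p_prime p_mod8 p_mod3 p5 1); [left|rewrite mul1r -pmulrn].
apply: (twist_torsion p p_prime p_mod8 p_mod3 p5 (-15)); first by right.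
by rewrite rmorphM rmorphN /= mulNr.
Qed.
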